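(* Let $H_0$ be a fixed graph on $h\ge 2$ vertices with at least one edge, let $\alpha>0$ be a constant, and let $m=m(n)=\lfloor n^\alpha\rfloor$. Let $\eta_0=\eta_0(H_0)$, the set $\mathcal{C}_0=\mathcal{C}_0(H_0)$ of clique covers, and the notion of strict $\alpha$-balancedness be as defined in the context. Suppose that $p=p(n)=cn^{-\eta_0}$ for a constant $c>0$ and that $mp^2=o(1)$ as $n\to\infty$. Let $X$ be the number of induced copies of $H_0$ in the random intersection graph $\mathcal{G}(n,m,p)$. If $H_0$ is strictly $\alpha$-balanced, then, as $n\to\infty$, $$d_{TV}(X,P_{\lambda_0})=o(1)\qquad\text{for}\qquad \lambda_0=\frac{1}{|\mathrm{aut}(H_0)|}\sum_{\mathbf{C}\in\mathcal{C}_0(H_0)}c^{\sum\mathbf{C}}.$$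
   Context: Random intersection graph. $\mathcal{G}(n,m,p)$ is the random graph on a labelled vertex set $\mathcal{V}$ with $|\mathcal{V}|=n$ defined using a set $\mathcal{W}$ of $m$ objects: each vertex $v$ has a random set $\mathcal{W}_v\subseteq\mathcal{W}$ with $\mathbb{P}\{w\in\mathcal{W}_v\}=p$ independently for all $w\in\mathcal{W}$, $v\in\mathcal{V}$; two distinct vertices $v_1,v_2$ are adjacent iff $\mathcal{W}_{v_1}\cap\mathcal{W}_{v_2}\ne\emptyset$. Induced copies. Let $K_{\mathcal{V}}$ be the complete graph on $\mathcal{V}$ and consider all subgraphs $H$ of $K_{\mathcal{V}}$ isomorphic to $H_0$. Such an $H$ is an induced copy of $H_0$ in $\mathcal{G}(n,m,p)$ if all of its edges are edges of $\mathcal{G}(n,m,p)$ and none of its non-edges (pairs of vertices of $H$ not adjacent in $H$) are edges of $\mathcal{G}(n,m,p)$. $\mathrm{aut}(H_0)$ is the set of automorphisms of $H_0$. Total variation. $P_\lambda$ is a Poisson random variable with parameter $\lambda$, and $d_{TV}(X,P_\lambda)=\frac12\sum_{k=0}^\infty|\mathbb{P}\{X=k\}-e^{-\lambda}\lambda^k/k!|$. Clique covers. A clique cover $\mathbf{C}=\{C_1,\dots,C_t\}$ of $H_0$ is a set of non-empty subsets of $V(H_0)$ such that (i) each $C_i$ induces a clique in $H_0$; (ii) for every edge $\{v_1,v_2\}\in E(H_0)$ there is $C_i\in\mathbf{C}$ with $v_1,v_2\in C_i$. It is proper if moreover (iii) $|C_i|\ge2$ for all $i$. $\mathcal{C}(H_0)$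 is the finite set of proper clique covers of $H_0$. Put $|\mathbf{C}|=t$ and $\sum\mathbf{C}=\sum_{i=1}^t|C_i|$. Restricted clique covers. For $\emptyset\ne S\subseteq V(H_0)$ define the multisets $\mathbf{C}[S]=\{C_i\cap S:|C_i\cap S|\ge1,\ i\in\{1,\dots,t\}\}$ and $\mathbf{C}'[S]=\{C_i\cap S:|C_i\cap S|\ge2,\ i\in\{1,\dots,t\}\}$. Here $|\mathbf{C}[S]|$, $|\mathbf{C}'[S]|$ are the numbers of elements counted with multiplicity, and $\sum\mathbf{C}[S]$, $\sum\mathbf{C}'[S]$ are the sums of the cardinalities $|C_i\cap S|$ of their elements, counted with multiplicity. Exponents. Define $$\eta_2(H_0,\mathbf{C},S)=\begin{cases}\dfrac{|S|+\alpha|\mathbf{C}[S]|}{\sum\mathbf{C}[S]}&\text{if either }\alpha<\dfrac{|S|}{\sum\mathbf{C}[S]-|\mathbf{C}[S]|}\text{ or }\sum\mathbf{C}[S]=|\mathbf{C}[S]|,\\[2mm]\dfrac{|S|+\alpha|\mathbf{C}'[S]|}{\sum\mathbf{C}'[S]}&\text{otherwise,}\end{cases}$$ with value $+\infty$ if $\sum\mathbf{C}[S]=0$; $$\eta_1(H_0,\mathbf{C})=\min_{\emptyset\ne S\subseteq V(H_0)}\eta_2(H_0,\mathbf{C},S),\qquad \eta_0(H_0)=\max_{\mathbf{C}\in\mathcal{C}(H_0)}\eta_1(H_0,\mathbf{C}),$$ $$\mathcal{C}_0(H_0)=\{\mathbf{C}\in\mathcal{C}(H_0):\eta_1(H_0,\mathbf{C})=\eta_0(H_0)\}.$$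 Balancedness. A clique cover $\mathbf{C}\in\mathcal{C}(H_0)$ is strictly $\alpha$-balanced if $\eta_2(H_0,\mathbf{C},S)>\eta_2(H_0,\mathbf{C},V(H_0))$ for all $\emptyset\subsetneq S\subsetneq V(H_0)$. The graph $H_0$ is strictly $\alpha$-balanced if all $\mathbf{C}\in\mathcal{C}_0(H_0)$ are strictly $\alpha$-balanced. *)

(* Defs.v *)
(* MathComp / MathComp-Analysis; the reals are an arbitrary [R : realType]. *)
From HB Require Import structures.
From mathcomp Require Import all_boot all_order all_fingroup all_algebra.
From mathcomp Require Import all_classical all_reals all_analysis.

Set Implicit Arguments.
Unset Strict Implicit.
Unset Printing Implicit Defensive.

Import Order.TTheory GRing.Theory Num.Theory.
Import numFieldNormedType.Exports.

Local Open Scope ring_scope.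

(* Throughout, the fixed graph H_0 is a symmetric irreflexive relation
   [e : rel T] on a finite type [T]. *)

Definition clique (T : finType) (e : rel T) (A : {set T}) : bool :=
  [forall x in A, forall y in A, (x != y) ==> e x y].

Definition clique_cover (T : finType) (e : rel T) (C : {set {set T}}) : bool :=
  [&& [forall A in C, A != finset.set0],
      [forall A in C, clique e A]
    & [forall x, forall y, e x y ==> [exists A in C, (x \in A) && (y \in A)]]].

Definition proper_covers (T : finType) (e : rel T) : {set {set {set T}}} :=
  [set C : {set {set T}} |
    clique_cover e C && [forall A in C, (2 <= #|A|)%N]].

Definition total_size (T : finType) (C : {set {set T}}) : nat :=
  (\sum_(A in C) #|A|)%N.

(* The multiset of the traces [A :&: S] (A in C) with at least [k] elements, as
   a sequence, so that a trace occurs once for each A yielding it: [k = 1]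
   gives C[S] and [k = 2] gives C'[S]. *)
Definition restricted (T : finType) (k : nat) (C : {set {set T}})
    (S : {set T}) : seq {set T} :=
  [seq A :&: S | A <- enum C & (k <= #|A :&: S|)%N].

Definition mcard (T : finType) (M : seq {set T}) : nat := size M.

Definition mtotal (T : finType) (M : seq {set T}) : nat :=
  (\sum_(B <- M) #|B|)%N.

(* In the second test the quotient is only relevant when its denominator is
   nonzero, since the case of a zero denominator is the other disjunct; the
   subtraction is in R. *)
Definition eta2 (R : realType) (T : finType) (alpha : R) (C : {set {set T}})
    (S : {set T}) : \bar R :=
  let C1 := restricted 1 C S in
  let C2 := restricted 2 C S in
  if mtotal C1 == 0%N then +oo%E
  else if (alpha < #|S|%:R / ((mtotal C1)%:R - (mcard C1)%:R))
          || (mtotal C1 == mcard C1)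
  then ((#|S|%:R + alpha * (mcard C1)%:R) / (mtotal C1)%:R)%:E
  else ((#|S|%:R + alpha * (mcard C2)%:R) / (mtotal C2)%:R)%:E.

Definition eta1 (R : realType) (T : finType) (alpha : R)
    (C : {set {set T}}) : \bar R :=
  \big[mine/+oo%E]_(S : {set T} | S != finset.set0) eta2 alpha C S.

(* Finite as soon as [e] has an edge: there is then a proper clique cover, and
   every proper clique cover is nonempty. *)
Definition eta0 (R : realType) (T : finType) (e : rel T) (alpha : R) : \bar R :=
  \big[maxe/-oo%E]_(C in proper_covers e) eta1 alpha C.

Definition optimal_covers (R : realType) (T : finType) (e : rel T)
    (alpha : R) : {set {set {set T}}} :=
  [set C in proper_covers e | eta1 alpha C == eta0 e alpha].

Definition strictly_balanced_cover (R : realType) (T : finType) (alpha : R)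
    (C : {set {set T}}) : Prop :=
  forall S : {set T}, S != finset.set0 -> S \proper [set: T]%SET ->
    (eta2 alpha C [set: T]%SET < eta2 alpha C S)%E.

Definition strictly_balanced (R : realType) (T : finType) (e : rel T)
    (alpha : R) : Prop :=
  forall C, C \in optimal_covers e alpha -> strictly_balanced_cover alpha C.

Definition graph_aut (T : finType) (e : rel T) : {set {perm T}} :=
  [set s : {perm T} | [forall x, forall y, e (s x) (s y) == e x y]].

(* A subgraph of the complete graph on [V] is a pair
   (vertex set, edge set), edges being two-element sets of vertices. *)
Definition is_subgraph (V : finType) (H : {set V} * {set {set V}}) : bool :=
  [forall A in H.2, (A \subset H.1) && (#|A| == 2%N)].

Definition is_iso_copy (T : finType) (e : rel T) (V : finType)
    (H : {set V} * {set {set V}}) : bool :=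
  [exists f : {ffun T -> V},
    [&& injectiveb f, H.1 == [set f x | x : T]
      & [forall x, forall y, e x y == ([set f x; f y] \in H.2)]]].

Definition is_induced (V : finType) (g : rel V)
    (H : {set V} * {set {set V}}) : bool :=
  [forall u in H.1, forall v in H.1,
    (u != v) ==> (([set u; v] \in H.2) == g u v)].

Definition induced_copies (T : finType) (e : rel T) (V : finType) (g : rel V) :
    nat :=
  #|[set H : {set V} * {set {set V}} |
      [&& is_subgraph H, is_iso_copy e H & is_induced g H]]|.

(* An outcome assigns to each vertex its set of objects. *)
Definition intersection_graph (V W : finType) (w : {ffun V -> {set W}}) :
    rel V :=
  fun u v => (u != v) && (w u :&: w v != finset.set0).

(* The nm events [z \in w v] are independent, each of probability [p].  This is
   a probability distribution when 0 <= p <= 1. *)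
Definition rig_weight (R : realType) (V W : finType) (p : R)
    (w : {ffun V -> {set W}}) : R :=
  \prod_(v : V) \prod_(z : W) bernoulli_pmf p (z \in w v).

Definition rig_prob (R : realType) (n m : nat) (p : R)
    (E : pred {ffun 'I_n -> {set 'I_m}}) : R :=
  \sum_(w | E w) rig_weight p w.

Definition copies_pmf (R : realType) (T : finType) (e : rel T) (n m : nat)
    (p : R) (k : nat) : R :=
  rig_prob p (fun w : {ffun 'I_n -> {set 'I_m}} =>
    induced_copies e (intersection_graph w) == k).

(* The total variation distance between the law on nat with mass function [f]
   and the Poisson law; the library's [poisson_pmf] is not used because it is
   constantly 1 at the rate 0. *)
Definition dTV_poisson (R : realType) (f : nat -> R) (lambda : R) : \bar R :=
  ((2^-1)%:E * \sum_(0 <= k <oo)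
     `|f k - expR (- lambda) * lambda ^+ k / (k`!)%:R|%:E)%E.

Definition lambda0 (R : realType) (T : finType) (e : rel T) (alpha c : R) : R :=
  (#|graph_aut e|%:R)^-1 *
  \sum_(C in optimal_covers e alpha) c ^+ total_size C.

(* Main.v *)
Require Import Defs.
From HB Require Import structures.
From mathcomp Require Import all_boot all_order all_fingroup all_algebra.
From mathcomp Require Import all_classical all_reals all_analysis.
From mathcomp Require Import ring lra zify.

(* Whenever a clique cover C appears on an induced copy of H_0 in the random
   intersection graph, every clique of C is the trace of an object, so the copy
   contains a copy of the incidence pattern of C in the random bipartite graph
   between vertices and objects.  A sub-pattern with vertices S and objects D is
   expected n^(|S| + alpha |D| - eta_0 sum_(A in D) |A :&: S|) times, up to
   constants.  For a cover outside C_0 some exponent is negative, so with high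
   probability such a cover does not occur.  For C in C_0 the exponent of the
   whole pattern is 0, and strict balancedness together with alpha < 2 eta_0
   (which is what m p^2 = o(1) says) makes all other exponents positive; hence
   overlapping pairs of patterns have negligible expected number, and with high
   probability each pattern present comes from exactly one induced copy.

   The number N of patterns with cover in C_0 is asymptotically Poisson: with
   lambda = E[N], conditioning on one pattern gives
   (k + 1) P(N = k + 1) = lambda P(N = k) + o(1) for each k, where the error is
   controlled by the overlapping pairs alone.  This recursion and the tail bound
   P(N >= K) <= lambda / K determine the limit law. *)

(** Placements with the same incidences must be counted once, so the recursion is run for the
    distinct edge sets of placements. Because an optimal cover reaches every vertex of $H_0$, two
    placements with equal edge sets differ by an automorphism; this gives the factor
    $1/|\mathrm{aut}(H_0)|$ in $\lambda_0$, and the same factor relates induced embeddings to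
    induced copies. Two kinds of overlapping pairs resist the exponent count. When all vertices and
    all objects are shared, the exponent is 0, and smallness comes from a single new incidence, a
    factor $p$. When one edge set contains the other, nothing is new in one direction, and the pair
    is charged to the other direction, at the cost of a factor 2. The recursion alone fixes the
    limit law only up to the mass at 0; the tail bound keeps mass from escaping to infinity and
    thereby determines that mass. *)

Set Implicit Arguments.
Unset Strict Implicit.
Unset Printing Implicit Defensive.

Import Order.TTheory GRing.Theory Num.Theory.
Import numFieldNormedType.Exports.

Local Open Scope ring_scope.

(** * Sets hit by a random subset of a finite set *)

Section RandomSubset.
Variables (R : realType) (Om : finType) (p : R).
Implicit Types (E G : {set Om}) (P Q : pred {set Om}).

Definition subset_weight G : R := \prod_(o : Om) bernoulli_pmf p (o \in G).

Definition subset_prob P : R := \sum_(G : {set Om} | P G) subset_weight G.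

Lemma subset_weight_total : \sum_G subset_weight G = 1.
Proof.
transitivity (\prod_(o : Om) (p + (1 - p))); first by rewrite bigA_distr.
by rewrite big1 // => o _; rewrite subrKC.
Qed.

(** A set that misses [o] and the same set with [o] added give the same [phi (o |: G)], so on the
    right the weights [p] and [1 - p] of [o] add up to 1. *)
Lemma subset_weight_tilt1 (o : Om) (phi : {set Om} -> R) :
  \sum_(G : {set Om} | o \in G) subset_weight G * phi G =
  p * \sum_G subset_weight G * phi (o |: G).
Proof.
pose r (G : {set Om}) : R := \prod_(o' | o' != o) bernoulli_pmf p (o' \in G).
have wE (G : {set Om}) : subset_weight G = bernoulli_pmf p (o \in G) * r G.
  by rewrite /subset_weight (bigD1 o).
rewrite [in RHS](bigID (fun G : {set Om} => o \in G)) /=.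
have -> : \sum_(G : {set Om} | o \notin G) subset_weight G * phi (o |: G) =
    \sum_(G : {set Om} | o \in G) (1 - p) * (r G * phi G).
  rewrite (reindex_onto (fun G : {set Om} => G :\ o) (fun G : {set Om} => o |: G)) /=; last first.
    by move=> G oG; rewrite setU1K.
  apply: eq_big => [G|G].
    rewrite !inE eqxx /=; apply/eqP/idP => [<-|]; first by rewrite !inE eqxx.
    exact: finset.setD1K.
  move=> /andP[_ /eqP oG]; rewrite oG wE mulrA; congr (_ * _ * _).
    by rewrite !inE eqxx.
  by apply: eq_bigr => o' /negPf o'o; rewrite !inE o'o.
rewrite mulrDr !big_distrr -big_split /=; apply: eq_bigr => G oG.
have -> : o |: G = G by apply/finset.setUidPr; rewrite finset.sub1set.
by rewrite wE oG /=; ring.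
Qed.

(** Conditioned on [E \subset G], the random set is distributed as [E :|: G] with [G] unconditioned:
    the form of independence on which the Poisson recursion rests. The elements of [E] are added one
    at a time. *)
Lemma subset_weight_tilt E (phi : {set Om} -> R) :
  \sum_(G : {set Om} | E \subset G) subset_weight G * phi G =
  p ^+ #|E| * \sum_G subset_weight G * phi (E :|: G).
Proof.
have [k] := ubnP #|E|; elim: k E phi => // k IH E phi.
have [->| [ o oE]] := set_0Vmem E.
  rewrite cards0 expr0 mul1r => _; apply: eq_big => [G|G _].
    by rewrite finset.sub0set.
  by rewrite finset.set0U.
rewrite (cardsD1 o) oE ltnS => Ek.
have -> : \sum_(G : {set Om} | E \subset G) subset_weight G * phi G =
    \sum_(G : {set Om} | o \in G) subset_weight G * (if E :\ o \subset G then phi G else 0).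
  under [RHS]eq_bigr do rewrite fun_if mulr0.
  rewrite -big_mkcondr; apply: eq_bigl => G.
  by rewrite -(finset.setD1K oE) finset.subUset finset.sub1set (finset.setD1K oE).
rewrite subset_weight_tilt1 exprS -mulrA; congr (_ * _).
under eq_bigr do rewrite fun_if mulr0.
rewrite -big_mkcond /=.
rewrite (eq_bigl (fun G : {set Om} => E :\ o \subset G)); last first.
  move=> G; rewrite -finset.subDset; suff -> : E :\ o :\ o = E :\ o by [].
  by apply/setP => x; rewrite !inE andbA andbb.
rewrite IH //; congr (_ * _); apply: eq_bigr => G _.
by rewrite finset.setUA (finset.setD1K oE).
Qed.

Lemma subset_prob_subset E P :
  subset_prob (fun G : {set Om} => (E \subset G) && P G) =
  p ^+ #|E| * subset_prob (fun G : {set Om} => P (E :|: G)).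
Proof.
have /= h := subset_weight_tilt E (fun G : {set Om} => (P G)%:R).
rewrite /subset_prob big_mkcondr; transitivity (\sum_(G : {set Om} | E \subset G) subset_weight G * (P G)%:R).
  by apply: eq_bigr => G _; case: (P G); rewrite ?mulr1 ?mulr0.
rewrite h [X in _ * X]big_mkcond; congr (_ * _); rewrite [RHS]big_mkcond; apply: eq_bigr => G _.
by case: (P _); rewrite ?mulr1 ?mulr0.
Qed.

Lemma subset_prob_supset E : subset_prob (fun G : {set Om} => E \subset G) = p ^+ #|E|.
Proof.
have := subset_prob_subset E xpredT; rewrite /subset_prob subset_weight_total mulr1 => <-.
by apply: eq_bigl => G; rewrite andbT.
Qed.

Hypothesis p01 : 0 <= p <= 1.

Lemma subset_weight_ge0 G : 0 <= subset_weight G.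
Proof. by apply: prodr_ge0 => o _; exact: bernoulli_pmf_ge0. Qed.

Lemma subset_prob_ge0 P : 0 <= subset_prob P.
Proof. by apply: sumr_ge0 => G _; exact: subset_weight_ge0. Qed.

Lemma subset_prob_le P Q : (forall G, P G -> Q G) -> subset_prob P <= subset_prob Q.
Proof.
move=> PQ; rewrite /subset_prob [leRHS](bigID P) /=.
rewrite (eq_bigl P); last by move=> G; case: (boolP (P G)) => [/PQ->//|]; rewrite ?andbF.
by rewrite lerDl; apply: sumr_ge0 => G _; exact: subset_weight_ge0.
Qed.

Lemma subset_prob_le1 P : subset_prob P <= 1.
Proof. by rewrite -subset_weight_total; exact: (@subset_prob_le P xpredT). Qed.

Lemma subset_prob_or P Q :
  subset_prob (fun G : {set Om} => P G || Q G) <= subset_prob P + subset_prob Q.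
Proof.
rewrite /subset_prob !(big_mkcond P) !(big_mkcond Q) (big_mkcond (fun G : {set Om} => _ || _)) -big_split /=.
apply: ler_sum => G _; have := subset_weight_ge0 G.
by case: (P G); case: (Q G) => /=; rewrite ?addr0 ?add0r // => w; rewrite lerDl.
Qed.

Lemma subset_prob_exists (I : finType) (A : pred I) (P : I -> pred {set Om}) :
  subset_prob (fun G : {set Om} => [exists i in A, P i G]) <= \sum_(i in A) subset_prob (P i).
Proof.
rewrite /subset_prob.
under [leRHS]eq_bigr do rewrite big_mkcond.
rewrite exchange_big /= big_mkcond; apply: ler_sum => G _.
have w0 := subset_weight_ge0 G.
case: ifP => [/existsP[i /andP[iA PiG]]|_].
  rewrite (bigD1 i) //= PiG lerDl; apply: sumr_ge0 => j _; by case: ifP.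
by apply: sumr_ge0 => j _; case: ifP.
Qed.

(** The coupling inequality: both events live on the same random set, so only outcomes on which they
    disagree contribute. *)
Lemma subset_prob_dist P Q :
  `|subset_prob P - subset_prob Q| <= subset_prob (fun G : {set Om} => P G != Q G).
Proof.
rewrite /subset_prob (big_mkcond P) (big_mkcond Q) -sumrB [leRHS]big_mkcond /=.
apply: le_trans (ler_norm_sum _ _ _) _; apply: ler_sum => G _.
have w0 := subset_weight_ge0 G.
by case: (P G); case: (Q G); rewrite /= ?subr0 ?sub0r ?normrN ?subrr ?normr0 // ger0_norm.
Qed.

Lemma subset_prob_sum (h : {set Om} -> nat) K :
  \sum_(0 <= k < K) subset_prob (fun G : {set Om} => h G == k) =
  subset_prob (fun G : {set Om} => h G < K)%N.
Proof.
rewrite big_mkord /subset_prob; under eq_bigr do rewrite big_mkcond.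
rewrite exchange_big /= [RHS]big_mkcond; apply: eq_bigr => G _.
rewrite -big_mkcond /=; case: ltnP => [hK|Kh].
  by rewrite (big_pred1 (Ordinal hK)).
by rewrite big_pred0 // => k; rewrite gtn_eqF // (leq_trans (ltn_ord k)).
Qed.

Variable F : {set {set Om}}.

Definition count_subsets G := #|[set E in F | E \subset G]|.

Definition mean_subsets : R := \sum_(E in F) p ^+ #|E|.

(** Adding [E] to [G] may fail to raise the count by exactly one in two ways: [E] was already
    contained in [G] (first term), or [E] completes another set that meets it (inner sum). Disjoint
    pairs cost nothing. *)
Definition overlap_error : R :=
  \sum_(E in F) (p ^+ #|E| * p ^+ #|E| +
    \sum_(E' in F | (E' != E) && ~~ [disjoint E & E'])
       p ^+ #|E| * p ^+ #|E' :\: E|).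

Lemma count_subsets_sum G : count_subsets G = (\sum_(E in F) (E \subset G))%N.
Proof. by rewrite /count_subsets -sum1dep_card big_mkcondr. Qed.

Lemma mean_subsetsE : \sum_G subset_weight G * (count_subsets G)%:R = mean_subsets.
Proof.
under eq_bigr do rewrite count_subsets_sum natr_sum big_distrr /=.
rewrite exchange_big /=; apply: eq_bigr => E _.
rewrite -subset_prob_supset /subset_prob [RHS]big_mkcond /=; apply: eq_bigr => G _.
by case: (E \subset G); rewrite ?mulr1 ?mulr0.
Qed.

Lemma count_subsets_markov K :
  K%:R * subset_prob (fun G : {set Om} => K <= count_subsets G)%N <= mean_subsets.
Proof.
rewrite -mean_subsetsE /subset_prob big_distrr /= big_mkcond; apply: ler_sum => G _.
have w0 := subset_weight_ge0 G.
case: ifP => [KG|_]; last by rewrite mulr_ge0.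
by rewrite mulrC ler_wpM2l // ler_nat.
Qed.

(** Markov's inequality, phrased through partial sums of the law so that the limit argument can be
    carried out for an abstract sequence of mass functions. *)
Lemma count_subsets_tail K :
  K%:R * (1 - \sum_(0 <= k < K) subset_prob (fun G : {set Om} => count_subsets G == k))
  <= mean_subsets.
Proof.
rewrite subset_prob_sum; apply: le_trans (count_subsets_markov K).
rewrite le_eqVlt; apply/orP; left; apply/eqP; congr (_ * _); apply/eqP.
rewrite subr_eq -subset_weight_total (bigID (fun G => K <= count_subsets G)%N) /=.
rewrite /subset_prob; apply/eqP; congr (_ + _); apply: eq_bigl => G.
by rewrite -ltnNge.
Qed.

Lemma count_subsets_add E G : E \in F ->
  (forall E', E' \in F -> E' != E -> ~~ [disjoint E & E'] -> ~~ (E' :\: E \subset G)) ->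
  ~~ (E \subset G) ->
  count_subsets (E :|: G) = (count_subsets G).+1.
Proof.
move=> EF dis nEG; rewrite /count_subsets.
have -> : [set E' in F | E' \subset E :|: G] = E |: [set E' in F | E' \subset G].
  apply/setP => E'; rewrite !inE; have [->|E'E] /= := eqVneq E' E.
    by rewrite EF finset.subsetUl.
  case: (boolP (E' \in F)) => //= E'F.
  have [dEE'|nd] := boolP [disjoint E & E'].
    apply/idP/idP => [/fintype.subsetP sub|/fintype.subset_trans]; last by apply; exact: finset.subsetUr.
    apply/fintype.subsetP => o oE'; have := sub _ oE'; rewrite inE => /orP[oE|//].
    by have := disjointFr dEE' oE; rewrite oE'.
  have /negPf nE := dis _ E'F E'E nd.
  rewrite -finset.subDset nE; apply/esym/negP => E'G.
  by move/negP: nE; apply; apply: fintype.subset_trans E'G; exact: finset.subsetDl.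
by rewrite cardsU1 inE EF (negPf nEG).
Qed.

(* Summing [k.+1 * P(N = k.+1)] over the member of [F] that is hit, the law of
   [G] conditioned on [E \subset G] is that of [E :|: G] by
   [subset_prob_subset], and adding [E] raises the count by exactly one unless
   [E] interacts with [G]. *)
Lemma count_subsets_recursion k :
  `| k.+1%:R * subset_prob (fun G : {set Om} => count_subsets G == k.+1)
     - mean_subsets * subset_prob (fun G : {set Om} => count_subsets G == k) |
  <= overlap_error.
Proof.
have -> : k.+1%:R * subset_prob (fun G : {set Om} => count_subsets G == k.+1) =
    \sum_(E in F) p ^+ #|E| *
       subset_prob (fun G : {set Om} => count_subsets (E :|: G) == k.+1).
  under [RHS]eq_bigr => E _ do
    rewrite -(subset_prob_subset E (fun G : {set Om} => count_subsets G == k.+1)).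
  rewrite /subset_prob; under [RHS]eq_bigr do rewrite big_mkcond /=.
  rewrite exchange_big /= big_distrr /= big_mkcond; apply: eq_bigr => G _.
  have [Gk|Gk] := eqVneq (count_subsets G) k.+1; last first.
    by rewrite big1 // => E _; rewrite andbF.
  under eq_bigr do rewrite andbT.
  rewrite -big_mkcondr /= sumr_const mulr_natl -{1}Gk; congr (_ *+ _).
  by rewrite /count_subsets; apply: eq_card => E; rewrite !inE.
rewrite /mean_subsets big_distrl -sumrB /=.
apply: le_trans (ler_norm_sum _ _ _) _; apply: ler_sum => E EF.
have pE : 0 <= p ^+ #|E| by rewrite exprn_ge0 //; case/andP: p01.
rewrite -mulrBr normrM ger0_norm // -big_distrr -mulrDr /=; apply: ler_wpM2l => //.
apply: le_trans (subset_prob_dist _ _) _.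
apply: (@le_trans _ _ (subset_prob (fun G : {set Om} => (E \subset G) ||
   [exists E' in [pred E' | (E' \in F) && ((E' != E) && ~~ [disjoint E & E'])],
      E' :\: E \subset G]))).
  apply: subset_prob_le => G; apply: contraNT; rewrite negb_or => /andP[nE /existsPn nE'].
  rewrite (@count_subsets_add E G) ?eqSS //.
  move=> E' E'F E'E dEE'; apply/negP => E'G.
  by have := nE' E'; rewrite !inE E'F E'E dEE' E'G.
apply: le_trans (subset_prob_or _ _) _; rewrite subset_prob_supset lerD2l.
apply: le_trans (subset_prob_exists _ _) _.
by rewrite le_eqVlt; apply/orP; left; apply/eqP/eq_bigr => E' _; rewrite subset_prob_supset.
Qed.

End RandomSubset.

Definition assignment (V W : finType) (G : {set V * W}) : {ffun V -> {set W}} :=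
  [ffun v => [set z | (v, z) \in G]].

Lemma rig_probE (R : realType) n m (p : R) (P : pred {ffun 'I_n -> {set 'I_m}}) :
  rig_prob p P = subset_prob p (fun G : {set 'I_n * 'I_m} => P (assignment G)).
Proof.
rewrite /rig_prob /subset_prob.
rewrite (reindex_onto (@assignment _ _) (fun w => [set o : 'I_n * 'I_m | o.2 \in w o.1])) /=; last first.
  by move=> w _; apply/ffunP => v; rewrite ffunE; apply/setP => z; rewrite !inE.
apply: eq_big => [G|G _].
  rewrite [X in _ && X](_ : _ = true) ?andbT //; apply/eqP/setP => -[v z].
  by rewrite !inE ffunE inE.
rewrite /rig_weight /subset_weight pair_bigA /=; apply: eq_bigr => -[v z] _ /=.
by rewrite ffunE inE.
Qed.

(** * Exponents of restricted clique covers *)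

(** To be read with [t1], [n1] the total and number of the traces in C[S], and [t2], [n2] those in
    C'[S]: the difference of total and number is the same for both families. *)
Lemma gap_arith (t1 t2 n1 n2 : nat) : (t1 + n2 = t2 + n1)%N -> (2 * n2 <= t2)%N ->
  [/\ t2 = n2 -> t2 = 0%N /\ n2 = 0%N, t1 = n1 -> t2 = n2 & t1 != n1 -> (n2 < t2)%N].
Proof. by move=> h1 h2; split=> [||/eqP]; lia. Qed.

Section Exponents.
Variables (R : realType) (T : finType) (alpha eta : R).
Implicit Types (S A : {set T}) (C D : {set {set T}}).

(* The expected number of copies of the bipartite incidence pattern with
   vertices [S] and objects [D] is of order [n `^ excess S D]. *)
Definition excess S D : R :=
  #|S|%:R + alpha * #|D|%:R - eta * (\sum_(A in D) #|A :&: S|)%:R.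

(** The multiset of traces is indexed by the cliques themselves, so that equal traces of different
    cliques stay distinct in a plain set. *)
Definition traced k C S : {set {set T}} := [set A in C | k <= #|A :&: S|]%N.

Lemma mcard_restricted k C S : mcard (restricted k C S) = #|traced k C S|.
Proof.
rewrite /mcard /restricted size_map cardE /traced; apply/perm_size/uniq_perm.
- exact: filter_uniq (enum_uniq _).
- exact: enum_uniq.
- by move=> A; rewrite mem_filter !mem_enum !inE andbC.
Qed.

Lemma mtotal_restricted k C S :
  mtotal (restricted k C S) = (\sum_(A in traced k C S) #|A :&: S|)%N.
Proof.
rewrite /mtotal /restricted big_map big_filter.
rewrite big_enum_cond /=; apply: eq_bigl => A; by rewrite !inE.
Qed.

(** The traces in C[S] that are missing from C'[S] are singletons, so they add as much to the total
    as to the number. *)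
Lemma traced_gap C S :
  (\sum_(A in traced 1 C S) #|A :&: S| + #|traced 2 C S| =
   \sum_(A in traced 2 C S) #|A :&: S| + #|traced 1 C S|)%N.
Proof.
have sub : traced 2 C S \subset traced 1 C S.
  by apply/fintype.subsetP => A; rewrite !inE => /andP[-> /ltnW].
rewrite (big_setID (traced 2 C S)) /= (finset.setIidPr sub).
rewrite -[#|traced 1 C S|](cardsID (traced 2 C S)) (finset.setIidPr sub).
have -> : (\sum_(A in traced 1 C S :\: traced 2 C S) #|A :&: S| =
   #|traced 1 C S :\: traced 2 C S|)%N; last first.
  by rewrite -addnA; congr addn; rewrite addnC.
rewrite -[RHS]sum1_card; apply: eq_bigr => A; rewrite !inE.
by case: (A \in C) => //=; case: #|_| => [|[|]].
Qed.

Lemma traced2_size C S :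
  (2 * #|traced 2 C S| <= \sum_(A in traced 2 C S) #|A :&: S|)%N.
Proof.
rewrite mulnC -sum_nat_const; apply: leq_sum => A; by rewrite inE => /andP[].
Qed.

(** The cliques contribute independently, so for fixed [S] the excess is least when exactly the
    cliques with negative contribution are kept. *)
Lemma excess_sum S D :
  excess S D = #|S|%:R + \sum_(A in D) (alpha - eta * #|A :&: S|%:R).
Proof.
rewrite /excess sumrB sumr_const -mulr_natr natr_sum -big_distrr /=; ring.
Qed.

(** Either quotient in [eta2] lies below [eta] exactly when the excess of its own family of cliques
    is negative. *)
Lemma eta2_lt_excess C S : (eta2 alpha C S < eta%:E)%E ->
  exists2 D : {set {set T}}, D \subset C & excess S D < 0.
Proof.
rewrite /eta2 !mtotal_restricted !mcard_restricted.
have sub k : traced k C S \subset C.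
  by apply/fintype.subsetP => A; rewrite inE => /andP[].
case: eqP => [//|/eqP T10]; case: ifP => [_|/norP[_ TN]]; rewrite lte_fin.
  rewrite ltr_pdivrMr ?ltr0n ?lt0n // => h; exists (traced 1 C S); first exact: sub.
  by rewrite /excess subr_lt0.
(* Otherwise every nonempty trace would be a singleton, which is the case excluded by the second
   test of [eta2]. *)
have T20 : (0 < \sum_(A in traced 2 C S) #|A :&: S|)%N.
  move: (traced_gap C S) (traced2_size C S) T10 TN.
  move: (\sum_(A in traced 1 C S) _)%N (\sum_(A in traced 2 C S) _)%N => t1 t2.
  move: #|_| #|_| => n2 n1. move=> h1 h2 /eqP h3 /eqP h4; lia.
rewrite ltr_pdivrMr ?ltr0n // => h; exists (traced 2 C S); first exact: sub.
by rewrite /excess subr_lt0.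
Qed.

Hypothesis alpha_gt0 : 0 < alpha.
Hypothesis alpha_lt : alpha < 2 * eta.

(* For fixed [S], [excess S D] is least at [D = traced 1 C S] if [alpha < eta]
   and at [D = traced 2 C S] otherwise; whichever quotient [eta2] selects, the
   test by which it is selected makes this least value positive. *)
Lemma eta2_gt_excess C S D : S != finset.set0 -> D \subset C ->
  (eta%:E < eta2 alpha C S)%E -> 0 < excess S D.
Proof.
move=> S0 DC; have s0 : (0 : R) < #|S|%:R by rewrite ltr0n card_gt0.
have [a0 a2] : 0 < alpha /\ alpha < 2 * eta by split.
have eta0 : 0 < eta by lra.
have lower k : (forall j, (k <= j)%N -> alpha - eta * j%:R <= 0) ->
    (forall j, (j < k)%N -> 0 <= alpha - eta * j%:R) ->
    excess S (traced k C S) <= excess S D.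
  move=> neg pos; rewrite !excess_sum lerD2l.
  rewrite (big_setID D) /= [leRHS](big_setID (traced k C S)) /=.
  rewrite finset.setIC -[leRHS]addr0 -addrA lerD2l addr0.
  apply: (@le_trans _ _ 0).
    by apply: sumr_le0 => A; rewrite !inE => /andP[_ /andP[_ /neg]].
  apply: sumr_ge0 => A; rewrite !inE => /andP[+ AD].
  by rewrite (fintype.subsetP DC _ AD) /= -ltnNge => /pos.
have lower1 : alpha < eta -> excess S (traced 1 C S) <= excess S D.
  move=> ae; apply: lower => [j j1|[|]// _]; last by lra.
  have : (1 : R) <= j%:R by rewrite ler1n.
  nra.
have lower2 : eta <= alpha -> excess S (traced 2 C S) <= excess S D.
  move=> ae; apply: lower => [j j2|[|[|]]// _]; [|lra|lra].
  have : (2 : R) <= j%:R by rewrite ler_nat.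
  nra.
rewrite /eta2 !mtotal_restricted !mcard_restricted.
have gap := traced_gap C S; have gap2 := traced2_size C S.
have gapR : ((\sum_(A in traced 1 C S) #|A :&: S|)%:R + #|traced 2 C S|%:R =
   (\sum_(A in traced 2 C S) #|A :&: S|)%:R + #|traced 1 C S|%:R :> R).
  by rewrite -!natrD gap.
move: lower1 lower2; rewrite /excess.
set t1 := (\sum_(A in traced 1 C S) _)%N in gap gapR *.
set t2 := (\sum_(A in traced 2 C S) _)%N in gap gap2 gapR *.
set n1 := #|traced 1 C S| in gap gapR *; set n2 := #|traced 2 C S| in gap gap2 gapR *.
move=> lower1 lower2.
have [eq0 n10 tn_lt] := gap_arith gap gap2.
have pos0 : t2 = n2 -> (0 : R) < #|S|%:R + alpha * n2%:R - eta * t2%:R.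
  by move=> /eq0[-> ->]; lra.
case: eqP => [t10 _|/eqP t10].
  have e1 : n1 = 0%N.
    apply/eqP; rewrite -leqn0 -t10 /n1 /t1 -sum1_card; apply: leq_sum => A.
    by rewrite inE => /andP[].
  have [ae|ae] := ltP alpha eta.
    by apply: lt_le_trans (lower1 ae); rewrite t10 e1; lra.
  by apply: lt_le_trans (lower2 ae); apply/pos0/n10; rewrite t10 e1.
have t1pos : (0 : R) < t1%:R by rewrite ltr0n lt0n.
have [tn|tn] := eqVneq t1 n1.
  rewrite orbT lte_fin ltr_pdivlMr // => h.
  have [ae|ae] := ltP alpha eta; first by apply: lt_le_trans (lower1 ae); lra.
  by apply: lt_le_trans (lower2 ae); exact/pos0/n10.
rewrite orbF.
have d0 : (0 : R) < t2%:R - n2%:R by rewrite subr_gt0 ltr_nat tn_lt.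
have -> : t1%:R - n1%:R = t2%:R - n2%:R :> R by lra.
case: ifP => [|/negbT].
  rewrite ltr_pdivlMr // lte_fin ltr_pdivlMr // => h1 h.
  have [ae|ae] := ltP alpha eta; first by apply: lt_le_trans (lower1 ae); lra.
  (* Here [eta2] uses C[S] although the least excess is at C'[S]. The test gives
     [alpha * (t2 - n2) < #|S|], so [#|S| + alpha * n2] exceeds [alpha * t2], which is at least
     [eta * t2]. *)
  have := ler_wpM2r (ler0n R t2) ae => aet.
  by apply: lt_le_trans (lower2 ae); lra.
have t20 : (0 : R) < t2%:R by apply: lt_le_trans d0 _; rewrite gerBl.
rewrite -leNgt ler_pdivrMr // lte_fin ltr_pdivlMr // => h1 h.
have [ae|ae] := ltP alpha eta; last by apply: lt_le_trans (lower2 ae); lra.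
(* This case is contradictory: the failed test gives [#|S| + alpha * n2 <= alpha * t2], hence at
   most [eta * t2], against the assumption on [eta2]. *)
have := ler_wpM2r (ltW t20) (ltW ae) => aet.
lra.
Qed.

End Exponents.

(** * Proper covers, finiteness of [eta0], and the exponents of optimal covers *)

Section Covers.
Variables (T : finType) (e : rel T).
Hypothesis eirr : irreflexive e.
Implicit Types (C D : {set {set T}}) (S A : {set T}).

Lemma proper_cover_size C A : C \in proper_covers e -> A \in C -> (2 <= #|A|)%N.
Proof. by rewrite inE => /andP[_ /forall_inP h] /h. Qed.

Lemma proper_cover_edge C x y : C \in proper_covers e ->
  e x y = (x != y) && [exists A in C, (x \in A) && (y \in A)].
Proof.
rewrite inE => /andP[/and3P[_ /forall_inP cl /forallP cov] _].
apply/idP/andP => [exy|[xy /exists_inP[A AC /andP[xA yA]]]].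
  split; first by apply: contraTneq exy => ->; rewrite eirr.
  by have /forallP/(_ y)/implyP := cov x; apply.
have /forall_inP/(_ _ xA)/forall_inP/(_ _ yA)/implyP := cl _ AC.
by apply.
Qed.

(** Covering every edge by itself shows that the maximum defining [eta0] runs over a nonempty
    set. *)
Lemma edge_cover_proper : symmetric e ->
  [set [set o.1; o.2] | o in [pred o : T * T | e o.1 o.2]] \in proper_covers e.
Proof.
move=> esym; rewrite inE; apply/andP; split; first (apply/and3P; split).
- apply/forall_inP => A /imsetP[[x y] _ ->]; apply/finset.set0Pn; exists x.
  by rewrite !inE eqxx.
- apply/forall_inP => A /imsetP[[x y]]; rewrite inE /= => exy ->.
  apply/forall_inP => u; rewrite !inE => uxy; apply/forall_inP => v; rewrite !inE => vxy.
  apply/implyP; case/orP: uxy => /eqP ->; case/orP: vxy => /eqP ->; rewrite ?eqxx // => _.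
  by rewrite esym.
- apply/forallP => x; apply/forallP => y; apply/implyP => exy.
  apply/exists_inP; exists [set x; y]; last by rewrite !inE !eqxx orbT.
  by apply/imsetP; exists (x, y).
- apply/forall_inP => A /imsetP[[x y]]; rewrite inE /= => exy ->.
  rewrite cards2; case: eqP exy => // ->; by rewrite eirr.
Qed.

Lemma proper_cover_neq0 C x y : C \in proper_covers e -> e x y -> C != finset.set0.
Proof.
move=> Cp; rewrite (proper_cover_edge _ _ Cp) => /andP[_ /exists_inP[A AC _]].
by apply/finset.set0Pn; exists A.
Qed.

Lemma proper_cover_total_gt0 C x y : C \in proper_covers e -> e x y ->
  (0 < total_size C)%N.
Proof.
move=> Cp exy; have /finset.set0Pn[A AC] := proper_cover_neq0 Cp exy.
rewrite /total_size (bigD1 A) //= addn_gt0 (leq_trans _ (proper_cover_size Cp AC)) //.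
Qed.

Lemma traced_setT k C : C \in proper_covers e -> (k <= 2)%N ->
  traced k C [set: T]%SET = C.
Proof.
move=> Cp k2; apply/setP => A; rewrite inE finset.setIT.
by case: (boolP (A \in C)) => //= /(proper_cover_size Cp); exact: leq_trans.
Qed.

Lemma sum_setT C : (\sum_(A in C) #|A :&: [set: T]| = total_size C)%N.
Proof. by apply: eq_bigr => A _; rewrite finset.setIT. Qed.

Variables (R : realType) (alpha : R).
Hypothesis esym : symmetric e.
Hypothesis hedge : exists x y, e x y.

(** Cliques of a proper cover have at least two vertices, so C[S] and C'[S] coincide for the full
    vertex set and both branches of [eta2] agree. *)
Lemma eta2_setT C : C \in proper_covers e -> eta2 alpha C [set: T]%SET =
  ((#|T|%:R + alpha * #|C|%:R) / (total_size C)%:R)%:E.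
Proof.
move=> Cp; rewrite /eta2 !mtotal_restricted !mcard_restricted !traced_setT // sum_setT cardsT.
have [x [y exy]] := hedge.
by rewrite gtn_eqF ?(proper_cover_total_gt0 Cp exy) //; case: ifP.
Qed.

Lemma eta1_le C S : S != finset.set0 -> (eta1 alpha C <= eta2 alpha C S)%E.
Proof. by move=> S0; exact: bigmin_le_cond. Qed.

Lemma eta0_ge C : C \in proper_covers e -> (eta1 alpha C <= eta0 e alpha)%E.
Proof. by move=> Cp; exact: le_bigmax_cond. Qed.

Lemma optimal_proper C : C \in optimal_covers e alpha -> C \in proper_covers e.
Proof. by rewrite inE => /andP[]. Qed.

Lemma optimal_exists : optimal_covers e alpha != finset.set0.
Proof.
pose C0 := [set [set o.1; o.2] | o in [pred o : T * T | e o.1 o.2]].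
have C0p : C0 \in proper_covers e := edge_cover_proper esym.
apply/finset.set0Pn; exists [arg max_(C > C0 in proper_covers e) eta1 alpha C]%O.
rewrite inE; case: arg_maxP => //= C Cp Cmax; rewrite Cp /=.
apply/eqP/le_anti; rewrite eta0_ge //= /eta0.
by apply: bigmax_le => [|C']; [exact: leNye | exact: Cmax].
Qed.

Lemma setT_neq0 : [set: T]%SET != finset.set0.
Proof. by have [x _] := hedge; apply/finset.set0Pn; exists x. Qed.

Hypothesis hbal : strictly_balanced e alpha.

Let eta : R := fine (eta0 e alpha).

(** Strict balancedness forces the minimum in [eta1] to be attained at the full vertex set, where
    [eta2] is a finite quotient. *)
Lemma optimal_eta C : C \in optimal_covers e alpha ->
  eta2 alpha C [set: T]%SET = eta0 e alpha /\
  eta0 e alpha = eta%:E.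
Proof.
move=> Co; have Cp := optimal_proper Co.
have : eta1 alpha C = eta0 e alpha by move: Co; rewrite inE => /andP[_ /eqP].
suff -> : eta1 alpha C = eta2 alpha C [set: T]%SET.
  by move=> h; split => //; rewrite /eta -h eta2_setT.
apply/le_anti; rewrite eta1_le ?setT_neq0 //=; apply: le_bigmin => [|S S0].
  exact: leey.
have [->//|ST] := eqVneq S [set: T]%SET; apply/ltW/hbal => //.
by rewrite properT.
Qed.

Lemma excess_optimal C : C \in optimal_covers e alpha ->
  excess alpha eta [set: T]%SET C = 0.
Proof.
move=> Co; have Cp := optimal_proper Co; have [h1 h2] := optimal_eta Co.
rewrite h2 eta2_setT // in h1; case: h1 => h1.
have [x [y exy]] := hedge.
rewrite /excess sum_setT cardsT -h1 divfK ?subrr //.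
by rewrite pnatr_eq0 -lt0n (proper_cover_total_gt0 Cp exy).
Qed.

Lemma eta0_fin : eta0 e alpha = eta%:E.
Proof. by have /finset.set0Pn[C /optimal_eta[]] := optimal_exists. Qed.

Lemma non_optimal_excess C : C \in proper_covers e -> C \notin optimal_covers e alpha ->
  exists S : {set T}, exists2 D : {set {set T}}, D \subset C & excess alpha eta S D < 0.
Proof.
move=> Cp; rewrite inE Cp /= => ne.
have : (eta1 alpha C < eta%:E)%E by rewrite -eta0_fin lt_neqAle ne eta0_ge.
rewrite ltNge => /negP h.
have [S S0 hS] : exists2 S : {set T}, S != finset.set0 & (eta2 alpha C S < eta%:E)%E.
  apply: contrapT => nS; apply: h; apply: le_bigmin => [|S S0]; first exact: leey.
  by rewrite leNgt; apply/negP => hS; apply: nS; exists S.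
by exists S; exact: eta2_lt_excess hS.
Qed.

Hypothesis alpha_gt0 : 0 < alpha.
Hypothesis alpha_lt : alpha < 2 * eta.

(** Without vertices, only [alpha * #|D|] is left. For a proper nonempty [S], strict balancedness
    applies. For the full vertex set, each clique [A] dropped from a pattern of exponent 0 removes
    [alpha - eta * #|A|], which is at most [alpha - 2 * eta] and so negative. *)
Lemma excess_gt0 C S D : C \in optimal_covers e alpha -> D \subset C ->
  (S != finset.set0) || (D != finset.set0) -> (S != [set: T]%SET) || (D != C) ->
  0 < excess alpha eta S D.
Proof.
move=> Co DC n0 n1; have Cp := optimal_proper Co.
have [h1 h2] := optimal_eta Co.
have [S0|S0] := eqVneq S finset.set0.
  rewrite S0 eqxx /= in n0; rewrite /excess S0 cards0 add0r big1 ?mulr0 ?subr0.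
    by rewrite mulr_gt0 // ltr0n card_gt0.
  by move=> A _; rewrite finset.setI0 cards0.
have [ST|ST] := eqVneq S [set: T]%SET; last first.
  apply: (eta2_gt_excess alpha_gt0 alpha_lt S0 DC).
  by rewrite -h2 -h1; apply: hbal => //; rewrite properT.
rewrite ST eqxx /= in n1; have := excess_optimal Co.
rewrite ST !excess_sum (big_setID D) /= (finset.setIidPr DC).
set a := \sum_(A in D) _; set b := \sum_(A in _) _; suff : b < 0 by lra.
have /finset.set0Pn[A AC] : C :\: D != finset.set0.
  rewrite finset.setD_eq0; apply: contra n1 => CD; by rewrite finset.eqEsubset DC.
have neg B : B \in C :\: D -> alpha - eta * #|B :&: [set: T]|%:R < 0.
  rewrite inE finset.setIT => /andP[_ /(proper_cover_size Cp) B2].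
  have : (2 : R) <= #|B|%:R by rewrite ler_nat.
  move: alpha_gt0 alpha_lt => ? ?; nra.
rewrite /b (bigD1 A) //=; apply: (@lt_le_trans _ _ (0 + 0)); last by rewrite addr0.
by apply: ltr_leD; [exact: neg | apply: sumr_le0 => B /andP[BC _]; exact/ltW/neg].
Qed.

(* Dropping an uncovered vertex would lower the exponent of the whole pattern,
   which is 0. *)
Lemma optimal_spanning C x : C \in optimal_covers e alpha ->
  exists2 A, A \in C & x \in A.
Proof.
move=> Co; have Cp := optimal_proper Co; apply: contrapT => nA.
have [u [v euv]] := hedge.
have : 0 < excess alpha eta ([set: T]%SET :\ x) C.
  apply: (@excess_gt0 C) => //.
    by rewrite (proper_cover_neq0 Cp euv) orbT.
  by apply/orP; left; apply/eqP => /setP/(_ x); rewrite !inE eqxx.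
have := excess_optimal Co; rewrite /excess.
rewrite (cardsD1 x [set: T]%SET) finset.in_setT add1n -natr1.
rewrite (eq_bigr (fun A => #|A :&: ([set: T]%SET :\ x)|)); first by lra.
move=> A AC; suff -> : A :&: [set: T]%SET = A :&: ([set: T]%SET :\ x) by [].
apply/setP => y; rewrite !inE andbT.
have [->|_] := eqVneq y x; rewrite ?andbT // andbF.
by apply/negbTE/negP => xA; apply: nA; exists A.
Qed.

End Covers.

(** * Automorphisms acting on covers *)

Section CoverAction.
Variables (R : realType) (T : finType) (e : rel T) (alpha : R).
Implicit Types (s : {perm T}) (C : {set {set T}}) (S A : {set T}).

Lemma imset_permKV s (A : {set T}) : s @: ((s^-1)%g @: A) = A.
Proof. by rewrite -imset_comp (eq_imset (g := id)) ?imset_id // => x /=; rewrite permKV. Qed.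

Lemma imset_permK s (A : {set T}) : (s^-1)%g @: (s @: A) = A.
Proof. by rewrite -{2}(invgK s) imset_permKV. Qed.

Definition cover_image s C : {set {set T}} := [set s @: (A : {set T}) | A in C].

Lemma imset_perm_inj s : injective (fun A : {set T} => s @: A).
Proof. exact: imset_inj perm_inj. Qed.

Lemma mem_cover_image s C (A : {set T}) : (s @: A \in cover_image s C) = (A \in C).
Proof. by rewrite mem_imset //; exact: imset_perm_inj. Qed.

Lemma card_imset_permI s (A S : {set T}) : #|s @: A :&: s @: S| = #|A :&: S|.
Proof.
rewrite -imsetI ?card_imset //; first exact: perm_inj.
by move=> x y _ _; exact: perm_inj.
Qed.

Lemma traced_image k s C (S : {set T}) :
  traced k (cover_image s C) (s @: S) = cover_image s (traced k C S).
Proof.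
apply/setP => B; rewrite inE; apply/andP/imsetP => [[/imsetP[A AC ->]]|[A + ->]].
  by rewrite card_imset_permI => kA; exists A; rewrite // inE AC.
by rewrite inE mem_cover_image card_imset_permI => /andP[].
Qed.

Lemma eta2_image s C (S : {set T}) : eta2 alpha (cover_image s C) (s @: S) = eta2 alpha C S.
Proof.
have sum_image k : (\sum_(A in cover_image s (traced k C S)) #|A :&: s @: S| =
    \sum_(A in traced k C S) #|A :&: S|)%N.
  rewrite big_imset /=; last by move=> A B _ _; exact: imset_perm_inj.
  by apply: eq_bigr => A _; exact: card_imset_permI.
rewrite /eta2 !mtotal_restricted !mcard_restricted !traced_image !sum_image.
rewrite !(card_imset _ (@imset_perm_inj s)).
by rewrite (card_imset _ (@perm_inj _ s)).
Qed.

Lemma eta1_image s C : eta1 alpha (cover_image s C) = eta1 alpha C.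
Proof.
rewrite /eta1 (reindex_inj (@imset_perm_inj s)) /=; apply: eq_big => [S|S _].
  by rewrite imset_eq0.
exact: eta2_image.
Qed.

Lemma graph_autP s : reflect (forall x y, e (s x) (s y) = e x y) (s \in graph_aut e).
Proof.
rewrite inE; apply: (iffP forallP) => [h x y|h x].
  by have /forallP/(_ y)/eqP := h x.
by apply/forallP => y; rewrite h.
Qed.

(** An automorphism carries the exponents along subset by subset; this is what keeps a relabelled
    placement among the placements of optimal covers. *)
Lemma optimal_image s C : s \in graph_aut e ->
  C \in optimal_covers e alpha -> cover_image s C \in optimal_covers e alpha.
Proof.
move=> /graph_autP hs; rewrite !inE eta1_image => /andP[/andP[/and3P[h1 h2 h3] h4] ->].
rewrite andbT; apply/andP; split; first (apply/and3P; split).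
- apply/forall_inP => _ /imsetP[A AC ->]; rewrite imset_eq0.
  exact: (forall_inP h1).
- apply/forall_inP => _ /imsetP[A AC ->]; have /forall_inP cA := forall_inP h2 _ AC.
  apply/forall_inP => _ /imsetP[x xA ->]; apply/forall_inP => _ /imsetP[y yA ->].
  by rewrite hs (inj_eq perm_inj); exact: (forall_inP (cA _ xA)).
- apply/forallP => x; apply/forallP => y; apply/implyP.
  rewrite -[x](permKV s) -[y](permKV s) hs => exy.
  have /exists_inP[A AC /andP[xA yA]] := implyP (forallP (forallP h3 _) _) exy.
  apply/exists_inP; exists (s @: A); first by rewrite mem_cover_image.
  by rewrite !mem_imset ?xA ?yA //; exact: perm_inj.
- apply/forall_inP => _ /imsetP[A AC ->]; rewrite card_imset; last exact: perm_inj.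
  exact: (forall_inP h4).
Qed.

Lemma graph_autV s : s \in graph_aut e -> (s^-1)%g \in graph_aut e.
Proof.
move=> /graph_autP hs; apply/graph_autP => x y.
by rewrite -[in RHS](permKV s x) -[in RHS](permKV s y) hs.
Qed.

End CoverAction.

(** * Placements of clique covers *)

Section Placements.
Variables (T V W : finType).
Implicit Types (f : {ffun T -> V}) (q : {ffun {set T} -> option W}) (A S : {set T}).
Implicit Types (D : {set {set T}}).

(* A placement of a clique cover of a graph on [T] is a pair of injections:
   [f] sends its vertices to [V], and [q] sends the cliques of the cover, which
   are the arguments at which [q] is defined, to objects in [W]. *)
Definition supp q : {set {set T}} := [set A | q A != None].

Definition placement f q : bool :=
  injectiveb f && [forall A in supp q, forall B in supp q, (q A == q B) ==> (A == B)].

Definition placed f q S D : {set V * W} :=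
  [set o | [exists A in D, (q A == Some o.2) && (o.1 \in f @: (A :&: S))]].

Definition edges f q : {set V * W} := placed f q [set: T] (supp q).

Lemma suppP q A : reflect (exists z, q A = Some z) (A \in supp q).
Proof.
by rewrite inE; case: (q A) => [z|]; constructor; [exists z | case].
Qed.

Lemma placement_inj f q : placement f q -> injective f.
Proof. by case/andP => /injectiveP. Qed.

Lemma placement_obj_inj f q A B z : placement f q ->
  q A = Some z -> q B = Some z -> A = B.
Proof.
case/andP => _ /forall_inP h qA qB.
have AC : A \in supp q by apply/suppP; exists z.
have BC : B \in supp q by apply/suppP; exists z.
by have /forall_inP/(_ _ BC) := h _ AC; rewrite qA qB eqxx => /eqP.
Qed.

Lemma edgesP f q v z :
  reflect (exists2 A, q A = Some z & v \in f @: A) ((v, z) \in edges f q).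
Proof.
rewrite inE; apply: (iffP exists_inP) => [[A _ /andP[/eqP qA]]|[A qA vA]].
  by rewrite finset.setIT; exists A.
exists A; first by apply/suppP; exists z.
by rewrite qA eqxx finset.setIT.
Qed.

Lemma mem_edges f q A v z : placement f q -> q A = Some z ->
  ((v, z) \in edges f q) = (v \in f @: A).
Proof.
move=> pl qA; apply/edgesP/idP => [[B qB]|vA]; last by exists A.
by rewrite (placement_obj_inj pl qA qB).
Qed.

Lemma card_placed f q S D : placement f q -> D \subset supp q ->
  #|placed f q S D| = (\sum_(A in D) #|A :&: S|)%N.
Proof.
move=> pl /fintype.subsetP sub; have finj := placement_inj pl.
pose P := [set u : {set T} * T | (u.1 \in D) && (u.2 \in u.1 :&: S)].
have <- : #|P| = (\sum_(A in D) #|A :&: S|)%N.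
  under [RHS]eq_bigr do rewrite -sum1_card.
  by rewrite pair_big_dep /= -sum1_card; apply: eq_bigl => u; rewrite !inE.
(* The two sides are compared inside [V * option W], where [q] can be applied to a clique without
   first extracting its object. *)
pose g (o : V * W) := (o.1, Some o.2).
have ginj : injective g by move=> [v z] [v' z'] [-> ->].
rewrite -(card_imset _ ginj).
pose k (u : {set T} * T) := (f u.2, q u.1).
have kinj : {in P &, injective k}.
  move=> [A x] [B y]; rewrite !inE /= => /andP[/sub AD _] /andP[/sub BD _] [/finj -> qAB].
  case/suppP: AD => z qA; congr pair; apply: (placement_obj_inj pl qA).
  by rewrite -qAB.
rewrite -(card_in_imset kinj); apply: eq_card => -[v oz]; apply/imsetP/imsetP.
  move=> [[v' z]]; rewrite inE => /exists_inP[A AD /= /andP[/eqP qA /imsetP[x xAS ->]]] [-> ->].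
  by exists (A, x); [rewrite inE AD | rewrite /k /= qA].
move=> [[A x]]; rewrite inE /= => /andP[AD xA] [-> ->].
have /suppP[z qA] := sub _ AD; exists (f x, z); last by rewrite /g /= qA.
rewrite inE; apply/exists_inP; exists A => //=; rewrite qA eqxx /=.
exact: imset_f.
Qed.

Lemma card_edges f q : placement f q -> #|edges f q| = total_size (supp q).
Proof.
move=> pl; rewrite /edges card_placed // /total_size.
by apply: eq_bigr => A _; rewrite finset.setIT.
Qed.

Section Fibres.
Variables (e : rel T) (CC : {set {set {set T}}}).
Hypothesis CC_edge : forall C x y, C \in CC ->
  e x y = (x != y) && [exists A in C, (x \in A) && (y \in A)].
Hypothesis CC_neq0 : forall C A, C \in CC -> A \in C -> A != finset.set0.
Hypothesis CC_span : forall C x, C \in CC -> exists2 A, A \in C & x \in A.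
Hypothesis CC_aut : forall C s, C \in CC -> s \in graph_aut e -> cover_image s C \in CC.

Definition placements : {set {ffun T -> V} * {ffun {set T} -> option W}} :=
  [set a | placement a.1 a.2 && (supp a.2 \in CC)].

Definition relabel (a : {ffun T -> V} * {ffun {set T} -> option W}) (s : {perm T}) :
  {ffun T -> V} * {ffun {set T} -> option W} :=
  ([ffun x => a.1 (s x)], [ffun A : {set T} => a.2 (s @: A)]).

Lemma edges_relabel a s : edges (relabel a s).1 (relabel a s).2 = edges a.1 a.2.
Proof.
have im (A : {set T}) : [ffun x => a.1 (s x)] @: A = a.1 @: (s @: A).
  by rewrite -imset_comp; apply: eq_imset => x; rewrite ffunE.
apply/setP => -[v z]; apply/edgesP/edgesP => /= -[A].
  by rewrite ffunE im => qA vA; exists (s @: A).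
move=> qA vA; exists ((s^-1)%g @: A).
  by rewrite ffunE imset_permKV.
by rewrite im imset_permKV.
Qed.

Lemma supp_relabel a s : supp (relabel a s).2 = cover_image (s^-1)%g (supp a.2).
Proof.
apply/setP => A; rewrite -[A in RHS](imset_permK s).
by rewrite mem_cover_image !inE ffunE.
Qed.

Lemma relabel_placements a s : s \in graph_aut e ->
  a \in placements -> relabel a s \in placements.
Proof.
move=> saut; rewrite !inE supp_relabel => /andP[pl aCC].
rewrite CC_aut ?graph_autV // andbT; apply/andP; split.
  by apply/injectiveP => x y; rewrite !ffunE => /(placement_inj pl)/perm_inj.
apply/forall_inP => A /suppP[z qA]; apply/forall_inP => B /suppP[z' qB].
apply/implyP => /eqP; rewrite qA => /esym; rewrite qB => -[zz'].
rewrite ffunE in qA; rewrite ffunE zz' in qB.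
by have /imset_perm_inj -> := placement_obj_inj pl qA qB.
Qed.

(** The incidences determine everything up to [s]. Since the covers span, the vertices occurring in
    them form the image of either map, which yields [s]; the vertices incident to an object are the
    image of its clique, so [s] also matches the cliques. Adjacency in [e] can be read off the
    cliques, so [s] is an automorphism. *)
Lemma edges_eq_relabel a b : a \in placements -> b \in placements ->
  edges b.1 b.2 = edges a.1 a.2 -> exists2 s, s \in graph_aut e & b = relabel a s.
Proof.
case: a => f q; case: b => f' q'; rewrite !inE /= => /andP[pl aCC] /andP[pl' bCC] eqE.
have finj := placement_inj pl; have f'inj := placement_inj pl'.
have /fin_all_exists[s0 fs0] x : exists y, f y = f' x.
  have [A /suppP[z qA] xA] := CC_span x bCC.
  have : (f' x, z) \in edges f' q' by rewrite (mem_edges _ pl' qA) imset_f.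
  by rewrite eqE => /edgesP[B _ /imsetP[y _ ->]]; exists y.
have s0inj : injective s0 by move=> x y sxy; apply: f'inj; rewrite -!fs0 sxy.
pose s := perm s0inj.
have fs x : f (s x) = f' x by rewrite permE.
have im (A : {set T}) : f @: (s @: A) = f' @: A.
  by rewrite -imset_comp; apply: eq_imset => x /=; exact: fs.
have qs (A : {set T}) : q (s @: A) = q' A.
  case q'A : (q' A) => [z|].
    have A'C : A \in supp q' by apply/suppP; exists z.
    have /finset.set0Pn[x xA] := CC_neq0 bCC A'C.
    have : (f' x, z) \in edges f' q' by rewrite (mem_edges _ pl' q'A) imset_f.
    rewrite eqE => /edgesP[B qB _]; rewrite -qB; congr (q _).
    apply: (imset_inj finj); rewrite im; apply/setP => v.
    by rewrite -(mem_edges _ pl qB) -(mem_edges _ pl' q'A) eqE.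
  case qA : (q (s @: A)) => [z|] //.
  have sAC : s @: A \in supp q by apply/suppP; exists z.
  have /finset.set0Pn[y yA] := CC_neq0 aCC sAC.
  have : (f y, z) \in edges f q by rewrite (mem_edges _ pl qA) imset_f.
  rewrite -eqE => /edgesP[B q'B _]; rewrite -q'A -q'B; congr (q' _).
  apply: (imset_inj f'inj); rewrite -[f' @: A]im; apply/setP => v.
  by rewrite -(mem_edges _ pl qA) -(mem_edges _ pl' q'B) eqE.
exists s; last first.
  by congr pair; [apply/ffunP => x; rewrite ffunE fs | apply/ffunP => A; rewrite ffunE qs].
have memC (A : {set T}) : (s @: A \in supp q) = (A \in supp q') by rewrite !inE qs.
apply/graph_autP => x y; rewrite (CC_edge _ _ aCC) (CC_edge _ _ bCC) (inj_eq perm_inj).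
congr andb; apply/exists_inP/exists_inP => -[A].
  rewrite -[A](imset_permKV s) memC !(mem_imset _ _ (@perm_inj _ s)) => AC xyA.
  by exists ((s^-1)%g @: A).
move=> AC xyA; exists (s @: A); first by rewrite memC.
by rewrite !(mem_imset _ _ (@perm_inj _ s)).
Qed.

(** A fibre of [edges] is one orbit of the automorphism group, and the action is free because the
    vertex map is injective. *)
Lemma card_edges_fibre a : a \in placements ->
  #|[set b in placements | edges b.1 b.2 == edges a.1 a.2]| = #|graph_aut e|.
Proof.
move=> aP; have -> : [set b in placements | edges b.1 b.2 == edges a.1 a.2] =
    relabel a @: graph_aut e.
  apply/setP => b; apply/idP/imsetP => [|[s saut ->]].
    by rewrite inE => /andP[bP /eqP ba]; exact: edges_eq_relabel.
  by rewrite inE relabel_placements ?edges_relabel ?eqxx.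
apply: card_imset => s t [/ffunP st _]; apply/permP => x.
have := aP; rewrite inE => /andP[/placement_inj ainj _].
by have := st x; rewrite !ffunE => /ainj.
Qed.

(** Used over [nat] to count the edge sets contained in [G], and over the reals to compute their
    mean. *)
Lemma sum_edges_fibre (R : pzSemiRingType) (phi : {set V * W} -> R) :
  \sum_(a in placements) phi (edges a.1 a.2) =
  #|graph_aut e|%:R * \sum_(E in [set edges a.1 a.2 | a in placements]) phi E.
Proof.
rewrite (partition_big_imset (fun a => edges a.1 a.2)) /= big_distrr /=.
apply: eq_bigr => _ /imsetP[a aP ->].
rewrite (eq_bigr (fun=> phi (edges a.1 a.2))); last by move=> b /andP[_ /eqP ->].
rewrite sumr_const -(card_edges_fibre aP) mulr_natl; congr (_ *+ _).
by apply: eq_card => b; rewrite [RHS]inE.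
Qed.

End Fibres.
End Placements.

(** * Induced copies as classes of injective maps *)

Section InducedEmbeddings.
Variables (T V : finType) (e : rel T).
Hypothesis (esym : symmetric e) (eirr : irreflexive e).
Implicit Types (f : {ffun T -> V}) (g : rel V).

Definition embedding_graph f : {set V} * {set {set V}} :=
  ([set f x | x : T], [set [set f o.1; f o.2] | o in [pred o : T * T | e o.1 o.2]]).

Definition induced_embeddings g : {set {ffun T -> V}} :=
  [set f : {ffun T -> V} | injectiveb f &&
    [forall x, forall y, (x != y) ==> (e x y == g (f x) (f y))]].

Lemma mem_embedding_graph f x y : injective f ->
  ([set f x; f y] \in (embedding_graph f).2) = e x y.
Proof.
move=> finj; apply/imsetP/idP => [[[u v]]|exy]; last by exists (x, y).
rewrite inE /= => euv /setP eqs.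
(* Testing the equality of the two pairs at their four elements leaves [x, y] equal to [u, v] in
   some order; symmetry absorbs the order and irreflexivity the degenerate cases. *)
have := eqs (f x); have := eqs (f y); have := eqs (f u); have := eqs (f v).
rewrite !inE !eqxx ?orbT !(inj_eq finj) /=.
have [vx|_] := eqVneq v x; have [vy|_] := eqVneq v y => // _;
  have [ux|_] := eqVneq u x; have [uy|_] := eqVneq u y => // _ _ _;
  move: euv; rewrite ?vx ?ux ?vy ?uy //.
all: try by rewrite esym.
all: subst => //; by rewrite ?eirr.
Qed.

(** Two induced embeddings have the same image graph precisely when they differ by an automorphism,
    so every copy comes from [#|graph_aut e|] embeddings. *)
Lemma induced_copiesE g : (#|graph_aut e| * induced_copies e g)%N =
  #|induced_embeddings g|.
Proof.
have fibre f : f \in induced_embeddings g ->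
    #|[set f' in induced_embeddings g | embedding_graph f' == embedding_graph f]|
    = #|graph_aut e|.
  rewrite inE => /andP[/injectiveP finj /forallP ind].
  have -> : [set f' in induced_embeddings g | embedding_graph f' == embedding_graph f]
      = [set [ffun x => f ((s : {perm T}) x)] | s in graph_aut e].
    apply/setP => f'; apply/idP/imsetP => [|[s /graph_autP saut ->]].
      rewrite inE [f' \in _]inE => /andP[/andP[/injectiveP f'inj _] /eqP ff'].
      have /fin_all_exists[s0 fs0] x : exists y, f y = f' x.
        have : f' x \in (embedding_graph f').1 by apply/imsetP; exists x.
        by rewrite ff' => /imsetP[y _ ->]; exists y.
      have s0inj : injective s0 by move=> x y sxy; apply: f'inj; rewrite -!fs0 sxy.
      exists (perm s0inj); last by apply/ffunP => x; rewrite ffunE permE.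
      apply/graph_autP => x y; rewrite !permE -(mem_embedding_graph _ _ finj) !fs0 -ff'.
      exact: mem_embedding_graph.
    have finj' : injective [ffun x => f (s x)].
      by move=> x y; rewrite !ffunE => /finj/perm_inj.
    rewrite inE [_ \in induced_embeddings _]inE; apply/andP; split.
      apply/andP; split; first exact/injectiveP.
      apply/forallP => x; apply/forallP => y; rewrite !ffunE -(saut x) -(inj_eq (@perm_inj _ s)).
      exact: (forallP (ind (s x))).
    apply/eqP; congr pair.
      apply/setP => v; apply/imsetP/imsetP => -[x _ ->].
        by rewrite ffunE; exists (s x).
      by exists ((s^-1)%g x); rewrite // ffunE permKV.
    apply/setP => B; apply/imsetP/imsetP => -[[x y]]; rewrite inE /= => exy ->.
      by exists (s x, s y); rewrite ?inE /= ?saut ?ffunE.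
    exists ((s^-1)%g x, (s^-1)%g y); first by rewrite inE /= -saut !permKV.
    by rewrite /= !ffunE !permKV.
  apply: card_imset => s t /ffunP st; apply/permP => x.
  by have := st x; rewrite !ffunE => /finj.
have image : [set H : {set V} * {set {set V}} |
      [&& is_subgraph H, is_iso_copy e H & is_induced g H]] =
    [set embedding_graph f | f in induced_embeddings g].
  apply/setP => H; rewrite inE; apply/and3P/imsetP => [[sub /existsP[f]]|[f]].
    move=> /and3P[/injectiveP finj /eqP H1 /forallP H2] ind.
    have mem x y : ([set f x; f y] \in H.2) = e x y.
      by have /forallP/(_ y)/eqP -> := H2 x.
    exists f.
      rewrite inE; apply/andP; split; first exact/injectiveP.
      apply/forallP => x; apply/forallP => y; apply/implyP => xy.
      have fH u : f u \in H.1 by rewrite H1 imset_f.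
      have /forall_inP/(_ _ (fH y))/implyP := forall_inP ind _ (fH x).
      by rewrite mem (inj_eq finj); exact.
    case: H H1 sub mem {H2 ind} => Vs Es /= -> sub mem; congr pair.
    apply/setP => B; apply/idP/imsetP => [BE|[[x y]]]; last first.
      by rewrite inE /= => exy ->; rewrite mem.
    have /andP[/fintype.subsetP BV B2] := forall_inP sub _ BE.
    have /cards2P[u [v [uv Buv]]] := B2.
    have /imsetP[x _ ux] : u \in [set f x | x : T] by apply: BV; rewrite Buv !inE eqxx.
    have /imsetP[y _ vy] : v \in [set f x | x : T] by apply: BV; rewrite Buv !inE eqxx orbT.
    rewrite ux vy in Buv; exists (x, y) => //=.
    by rewrite inE /= -mem -Buv.
  rewrite inE => /andP[/injectiveP finj /forallP ind] ->; split.
  - apply/forall_inP => B /imsetP[[x y]]; rewrite inE /= => exy ->.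
    rewrite finset.subUset !finset.sub1set !imset_f //= cards2 (inj_eq finj).
    by have -> : x != y by apply: contraTneq exy => ->; rewrite eirr.
  - apply/existsP; exists f; apply/and3P; split; [exact/injectiveP | exact: eqxx |].
    by apply/forallP => x; apply/forallP => y; rewrite mem_embedding_graph.
  - apply/forall_inP => _ /imsetP[x _ ->]; apply/forall_inP => _ /imsetP[y _ ->].
    by rewrite mem_embedding_graph // (inj_eq finj); exact: (forallP (ind x)).
rewrite /induced_copies image -[RHS]sum1_card.
rewrite (partition_big_imset embedding_graph) /= mulnC -sum_nat_const.
apply: eq_bigr => _ /imsetP[f fI ->]; rewrite sum1dep_card (fibre f fI); reflexivity.
Qed.

End InducedEmbeddings.

(** * Correspondence between induced copies and patterns on a good event *)

Section Decoding.
Variables (T V W : finType) (e : rel T) (CC : {set {set {set T}}}).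
Hypothesis (e_sym : symmetric e) (eirr : irreflexive e).
Hypothesis CC_proper : forall C, C \in CC -> C \in proper_covers e.
Hypothesis CC_span : forall C x, C \in CC -> exists2 A, A \in C & x \in A.
Hypothesis CC_aut : forall C s, C \in CC -> s \in graph_aut e -> cover_image s C \in CC.
Variable G : {set V * W}.

Let g : rel V := intersection_graph (assignment G).

Let gP u v : reflect (u != v /\ exists z, (u, z) \in G /\ (v, z) \in G) (g u v).
Proof.
apply: (iffP andP) => -[uv].
  by move=> /finset.set0Pn[z]; rewrite !ffunE !inE => /andP[uz vz]; split => //; exists z.
move=> [z [uz vz]]; split => //; apply/finset.set0Pn; exists z.
by rewrite !ffunE !inE uz vz.
Qed.

(** The good event is split by what a failure costs: a suboptimal cover contains a sub-pattern of
    negative exponent, an extra incidence at an object in use costs a factor [p], and an extra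
    object seen by two vertices of the copy costs a factor [m * p ^+ 2]. *)
Definition only_in_CC : bool :=
  [forall f : {ffun T -> V}, forall q : {ffun {set T} -> option W},
    [&& placement f q, supp q \in proper_covers e & edges f q \subset G] ==>
    (supp q \in CC)].

Definition no_extra_edge : bool :=
  [forall a in placements V W CC, (edges a.1 a.2 \subset G) ==>
    [forall x, forall A, forall z, (a.2 A == Some z) ==> (x \notin A) ==>
      ((a.1 x, z) \notin G)]].

Definition no_extra_object : bool :=
  [forall a in placements V W CC, (edges a.1 a.2 \subset G) ==>
    [forall z, forall x, forall y, (x != y) ==> ((a.1 x, z) \in G) ==>
      ((a.1 y, z) \in G) ==> [exists A, a.2 A == Some z]]].

Hypotheses (hCC : only_in_CC) (hedge : no_extra_edge) (hobj : no_extra_object).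

Let CC_edge C x y : C \in CC ->
  e x y = (x != y) && [exists A in C, (x \in A) && (y \in A)].
Proof. by move=> /CC_proper; exact: proper_cover_edge. Qed.

Let CC_neq0 C A : C \in CC -> A \in C -> A != finset.set0.
Proof.
move=> /CC_proper Cp AiC; rewrite -card_gt0; exact: leq_trans (proper_cover_size Cp AiC).
Qed.

Definition present : {set {ffun T -> V} * {ffun {set T} -> option W}} :=
  [set a in placements V W CC | edges a.1 a.2 \subset G].

Lemma present_mem a A x z : a \in present -> a.2 A = Some z ->
  (a.1 x, z) \in G -> x \in A.
Proof.
rewrite inE => /andP[aP aG] qA xz.
have /implyP/(_ aG)/forallP/(_ x)/forallP/(_ A)/forallP/(_ z) := forall_inP hedge _ aP.
by rewrite qA eqxx xz implybF negbK.
Qed.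

Lemma present_edge a A x z : a \in present -> a.2 A = Some z -> x \in A -> (a.1 x, z) \in G.
Proof.
rewrite inE => /andP[_ /fintype.subsetP aG] qA xA; apply: aG.
by apply/edgesP; exists A; rewrite ?imset_f.
Qed.

Lemma present_object a x y z : a \in present -> x != y ->
  (a.1 x, z) \in G -> (a.1 y, z) \in G -> exists A, a.2 A = Some z.
Proof.
rewrite inE => /andP[aP aG] xy xz yz.
have /implyP/(_ aG)/forallP/(_ z)/forallP/(_ x)/forallP/(_ y) := forall_inP hobj _ aP.
by rewrite xy xz yz => /existsP[A /eqP]; exists A.
Qed.

Lemma present_inj a : a \in present -> injective a.1.
Proof. by rewrite !inE => /andP[/andP[/placement_inj]]. Qed.

Lemma present_supp a : a \in present -> supp a.2 \in CC.
Proof. by rewrite !inE => /andP[/andP[]]. Qed.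

Lemma present_induced a : a \in present -> a.1 \in induced_embeddings e g.
Proof.
move=> aP; have ainj := present_inj aP; have aC := present_supp aP.
rewrite inE; apply/andP; split; first exact/injectiveP.
apply/forallP => x; apply/forallP => y; apply/implyP => xy; apply/eqP.
rewrite (CC_edge _ _ aC) xy /=; apply/exists_inP/gP.
  move=> [A /suppP[z qA] /andP[xA yA]]; split; first by rewrite (inj_eq ainj).
  by exists z; split; exact: (present_edge aP qA).
move=> [_ [z [xz yz]]]; have [A qA] := present_object aP xy xz yz.
exists A; first by apply/suppP; exists z.
by rewrite !(present_mem aP qA).
Qed.

(** An object placed by [a] is seen by at least two vertices of the copy, hence it is also an object
    of [b]. Its clique is its exact trace on the copy in both placements. *)
Lemma present_objects_sub a b A z : a \in present -> b \in present -> a.1 = b.1 ->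
  a.2 A = Some z -> b.2 A = Some z.
Proof.
move=> aP bP ab qA; have AiC : A \in supp a.2 by apply/suppP; exists z.
have A2 := proper_cover_size (CC_proper (present_supp aP)) AiC.
have /card_gt1P[x [y [xA yA xy]]] := A2.
have inG u : u \in A -> (b.1 u, z) \in G.
  by rewrite -ab; exact: (present_edge aP qA).
have [B qB] := present_object bP xy (inG x xA) (inG y yA).
suff -> : A = B by [].
apply/setP => u; apply/idP/idP => [/inG|uB]; first exact: (present_mem bP qB).
by apply: (present_mem aP qA); rewrite ab; exact: (present_edge bP qB).
Qed.

Lemma present_fst_inj : {in present &, injective (fun a => a.1)}.
Proof.
move=> a b aP bP /= ab; have qq A : a.2 A = b.2 A.
  case aA : (a.2 A) => [z|]; first by rewrite (present_objects_sub aP bP ab aA).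
  case bA : (b.2 A) => [z|] //.
  by rewrite (present_objects_sub bP aP (esym ab) bA) in aA.
case: a b ab qq {aP bP} => f q [f' q'] /= -> qq; congr pair.
exact/ffunP.
Qed.

Lemma induced_present f : f \in induced_embeddings e g ->
  exists2 a, a \in present & a.1 = f.
Proof.
rewrite inE => /andP[/injectiveP finj /forallP ind].
have edge x y : e x y = (x != y) && [exists z, ((f x, z) \in G) && ((f y, z) \in G)].
  have [->|xy] := eqVneq x y; first by rewrite eirr.
  have /forallP/(_ y) := ind x; rewrite xy /= => /eqP ->; apply/gP/existsP.
    by move=> [_ [z [xz yz]]]; exists z; rewrite xz yz.
  move=> [z /andP[xz yz]]; split; first by rewrite (inj_eq finj).
  by exists z.
pose tr z := [set x | (f x, z) \in G].
(* The cover read off from [G] consists of the traces with at least two vertices; where several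
   objects leave the same trace, [pick] selects one of them. *)
pose q := [ffun A : {set T} => if (2 <= #|A|)%N then [pick z | tr z == A] else None].
have qtr A z : q A = Some z -> tr z = A /\ (2 <= #|A|)%N.
  by rewrite ffunE; case: ifP => // A2; case: pickP => // z' /eqP trz [<-].
have pl : placement f q.
  apply/andP; split; first exact/injectiveP.
  apply/forall_inP => A /suppP[z qA]; apply/forall_inP => B /suppP[z' qB].
  apply/implyP; rewrite qA qB => /eqP[zz'].
  by rewrite -(qtr _ _ qA).1 -(qtr _ _ qB).1 zz'.
have eG : edges f q \subset G.
  apply/fintype.subsetP => -[v z] /edgesP[A qA /imsetP[x xA ->]].
  by move: xA; rewrite -(qtr _ _ qA).1 inE.
have qC : supp q \in proper_covers e.
  rewrite inE; apply/andP; split; first (apply/and3P; split).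
  - apply/forall_inP => A /suppP[z /qtr[_ A2]].
    by rewrite -card_gt0; exact: leq_trans A2.
  - apply/forall_inP => A /suppP[z /qtr[<- _]].
    apply/forall_inP => x; rewrite inE => xz; apply/forall_inP => y; rewrite inE => yz.
    by apply/implyP => xy; rewrite edge xy; apply/existsP; exists z; rewrite xz yz.
  - apply/forallP => x; apply/forallP => y; apply/implyP.
    rewrite edge => /andP[xy /existsP[z /andP[xz yz]]].
    have tr2 : (2 <= #|tr z|)%N by apply/card_gt1P; exists x, y; rewrite !inE.
    apply/exists_inP; exists (tr z); last by rewrite !inE xz yz.
    rewrite inE ffunE tr2; case: pickP => // /(_ z); by rewrite eqxx.
  - by apply/forall_inP => A /suppP[z /qtr[]].
exists (f, q) => //; rewrite !inE /= pl eG andbT /=.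
by have /forallP/(_ q)/implyP := forallP hCC f; apply; rewrite pl qC.
Qed.

Lemma card_present : #|present| = #|induced_embeddings e g|.
Proof.
rewrite -(card_in_imset present_fst_inj); apply: eq_card => f.
apply/imsetP/idP => [[a aP ->]|/induced_present[a aP <-]]; first exact: present_induced.
by exists a.
Qed.

(** Multiplied by [#|graph_aut e|], both sides count the placements present in [G]: the left one
    through induced embeddings, the right one through the fibres of [edges]. *)
Lemma induced_copies_count :
  induced_copies e g =
  count_subsets [set edges a.1 a.2 | a in placements V W CC] G.
Proof.
have aut0 : (0 < #|graph_aut e|)%N.
  by apply/card_gt0P; exists 1%g; apply/graph_autP => x y; rewrite !perm1.
apply/eqP; rewrite -(eqn_pmul2l aut0) induced_copiesE // -card_present; apply/eqP.
rewrite count_subsets_sum.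
have := @sum_edges_fibre T V W e CC CC_edge CC_neq0 CC_span CC_aut nat (fun E => E \subset G).
rewrite natn => h; apply: etrans h.
rewrite /present -sum1_card.
rewrite (eq_bigl (fun a => (a \in placements V W CC) && (edges a.1 a.2 \subset G))); last first.
  by move=> a; rewrite inE.
rewrite big_mkcondr.
by apply: eq_bigr => a _; case: (_ \subset _).
Qed.

End Decoding.

(** * Counting placements and bounding error probabilities *)

Section PlacementCounts.
Variables (T V W : finType).
Implicit Types (f : {ffun T -> V}) (q : {ffun {set T} -> option W}) (A S : {set T}).
Implicit Types (C D : {set {set T}}).

Lemma card_family_prod (aT rT : finType) (F : aT -> pred rT) :
  #|family (fun x => mem (F x))| = (\prod_x #|F x|)%N.
Proof. by rewrite card_family foldrE big_map big_enum. Qed.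

Lemma card_some (U : finType) : #|[pred o : option U | o != None]| = #|U|.
Proof.
rewrite -cardsT -(card_imset [set: U] (@Some_inj _)); apply: eq_card => -[u|]; rewrite !inE.
  by apply/esym/imsetP; exists u.
by apply/esym/negbTE/imsetP => -[].
Qed.

Lemma supp_pffun q C : supp q = C -> q \in pffun_on None C [pred o | o != None].
Proof.
move=> <-; apply/pfamilyP; split.
  by apply/fintype.subsetP => A; rewrite !inE.
by move=> A; rewrite !inE.
Qed.

Lemma card_supp_le C : (#|[set q : {ffun {set T} -> option W} | supp q == C]| <= #|W| ^ #|C|)%N.
Proof.
rewrite -(card_some W) -(card_pffun_on None).
apply: subset_leq_card; apply/fintype.subsetP => q; rewrite inE => /eqP; exact: supp_pffun.
Qed.

Definition placements_of C : {set {ffun T -> V} * {ffun {set T} -> option W}} :=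
  [set a | placement a.1 a.2 && (supp a.2 == C)].

Lemma card_placements_of_le C : (#|placements_of C| <= #|V| ^ #|T| * #|W| ^ #|C|)%N.
Proof.
apply: (@leq_trans #|finset.setX [set: {ffun T -> V}] [set q : {ffun {set T} -> option W} | supp q == C]|).
  by apply: subset_leq_card; apply/fintype.subsetP => a; rewrite !inE => /andP[].
by rewrite cardsX cardsT card_ffun leq_mul // card_supp_le.
Qed.

Lemma card_placements_of_ge C :
  (#|V| ^_ #|T| * #|W| ^_ #|C| <= #|placements_of C|)%N.
Proof.
pose U := {A : {set T} | A \in C}.
pose ext (g : {ffun U -> W}) : {ffun {set T} -> option W} :=
  [ffun A => if insub A is Some u then Some (g u) else None].
have extE g (u : U) : ext g (val u) = Some (g u) by rewrite ffunE valK.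
have ext_inj : injective ext.
  move=> g h gh; apply/ffunP => u; apply: Some_inj; by rewrite -!extE gh.
have cardU : #|{: U}| = #|C| by rewrite card_sig; apply: eq_card.
rewrite -card_inj_ffuns -[X in (_ * _ ^_ X)%N]cardU -card_inj_ffuns.
rewrite -(card_imset [set g : {ffun U -> W} | injectiveb g] ext_inj) -cardsX.
apply: subset_leq_card; apply/fintype.subsetP => -[f q]; rewrite !inE /=.
case/andP => finj /imsetP[g]; rewrite inE => /injectiveP ginj ->.
have supp_ext : supp (ext g) = C.
  apply/setP => A; rewrite inE ffunE; case: insubP => [u|/negPf ->] //=.
rewrite supp_ext eqxx andbT /placement finj supp_ext /=.
apply/forall_inP => A AiC; apply/forall_inP => B BiC.
rewrite (_ : A = val (exist _ A AiC : U)) // (_ : B = val (exist _ B BiC : U)) //.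
by rewrite !extE; apply/implyP => /eqP[/ginj ->].
Qed.

(** A sub-pattern depends only on the restrictions of [f] to [S] and of [q] to [D]; many placements
    share it, so the distinct images are counted. *)
Lemma card_placed_image_le C S D : D \subset C ->
  (#|[set placed a.1 a.2 S D | a in placements_of C]| <= #|V| ^ #|S| * #|W| ^ #|D|)%N.
Proof.
move=> DC.
pose rf f : {ffun T -> option V} := [ffun x => if x \in S then Some (f x) else None].
pose rq q : {ffun {set T} -> option W} := [ffun A => if A \in D then q A else None].
pose h (b : {ffun T -> option V} * {ffun {set T} -> option W}) : {set V * W} :=
  [set o | [exists A, (b.2 A == Some o.2) && [exists x in A, b.1 x == Some o.1]]].
have placedE f q : placed f q S D = h (rf f, rq q).
  apply/setP => -[v z]; rewrite !inE /=; apply/exists_inP/existsP => -[A].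
    move=> AD /andP[qA /imsetP[x]]; rewrite inE => /andP[xA xS] ->.
    exists A; rewrite ffunE AD qA /=; apply/exists_inP; exists x => //.
    by rewrite ffunE xS.
  rewrite ffunE; case: ifP => // AD /andP[qA /exists_inP[x xA]].
  rewrite ffunE; case: ifP => // xS /eqP[<-]; exists A => //.
  by rewrite qA imset_f // inE xA.
rewrite -(card_some W) -(card_pffun_on None D) -(card_some V) -(card_pffun_on None S).
rewrite -cardX; apply: leq_trans (leq_imset_card h _).
apply: subset_leq_card; apply/fintype.subsetP => E /imsetP[[f q]].
rewrite inE => /andP[pl /eqP qC] -> /=; rewrite placedE; apply: imset_f.
rewrite inE /=; apply/andP; split; apply/pfamilyP; split.
- by apply/fintype.subsetP => x; rewrite inE ffunE; case: ifP.
- by move=> x xS; rewrite ffunE xS inE.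
- by apply/fintype.subsetP => x; rewrite inE ffunE; case: ifP.
- move=> A AD; rewrite ffunE AD.
  by have := fintype.subsetP DC _ AD; rewrite -qC inE.
Qed.

Definition shared_vertices f f' : {set T} := [set x | f' x \in f @: [set: T]].

Definition shared_cliques q q' : {set {set T}} :=
  [set A in supp q' | q' A \in q @: supp q].

(** A shared vertex has at most [#|T|] possible images and a shared clique at most [#|supp q|]; the
    remaining vertices and cliques are placed freely. *)
Lemma card_overlap_le f q C S D : D \subset C ->
  (#|[set b in placements_of C | (shared_vertices f b.1 == S) &&
       (shared_cliques q b.2 == D)]|
   <= (#|T| ^ #|S| * #|V| ^ (#|T| - #|S|)) *
      (#|supp q| ^ #|D| * #|W| ^ (#|C| - #|D|)))%N.
Proof.
move=> DC.
pose F (x : T) : {set V} := if x \in S then f @: [set: T] else [set: V].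
pose Q (A : {set T}) : {set option W} := if A \in D then q @: supp q
  else if A \in C then [set o | o != None] else [set None].
have cF : (#|family (fun x => mem (F x))| <= #|T| ^ #|S| * #|V| ^ (#|T| - #|S|))%N.
  rewrite card_family_prod (bigID (mem S)) /=; apply: leq_mul.
    rewrite -prod_nat_const; apply: leq_prod => x xS; rewrite /F xS.
    by rewrite -[leqRHS]cardsT; exact: leq_imset_card.
  have -> : (#|T| - #|S| = #|~: S|)%N by rewrite [RHS]cardsCs finset.setCK.
  rewrite -prod_nat_const; apply: eq_leq; apply: eq_big => [x|x /negPf xS].
    by rewrite !inE.
  by rewrite /F xS cardsT.
have cQ : (#|family (fun A => mem (Q A))| <= #|supp q| ^ #|D| * #|W| ^ (#|C| - #|D|))%N.
  rewrite card_family_prod (bigID (mem D)) /=; apply: leq_mul.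
    rewrite -prod_nat_const; apply: leq_prod => A AD; rewrite /Q AD.
    exact: leq_imset_card.
  rewrite (bigID (mem C)) /= [X in (_ * X)%N]big1 ?muln1; last first.
    by move=> A /andP[/negPf AD /negPf AiC]; rewrite /Q AD AiC cards1.
  have -> : (#|C| - #|D| = #|C :\: D|)%N by rewrite cardsD (finset.setIidPr DC).
  rewrite -prod_nat_const; apply: eq_leq; apply: eq_big => [A|A /andP[/negPf AD AiC]].
    by rewrite !inE.
  by rewrite /Q AD AiC cardsE card_some.
apply: leq_trans (leq_mul cF cQ); rewrite -cardX; apply: subset_leq_card.
apply/fintype.subsetP => -[f' q'] /setIdP[/setIdP[_ /= /eqP q'C] /andP[/eqP fS /eqP qD]].
apply/andP; split => /=.
  apply/familyP => x; rewrite /F; case: ifP => // xS.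
  by move: xS; rewrite -fS inE.
apply/familyP => A; rewrite /Q; case: ifP => [|AD].
  by rewrite -qD inE => /andP[].
by rewrite -q'C; case: ifP => [|/negbT]; rewrite !inE ?negbK.
Qed.

(** An incidence common to both edge sets joins a shared vertex to a shared object, so it belongs to
    the shared sub-pattern; the converse may fail, whence an inequality. *)
Lemma card_edges_setD f q f' q' : placement f q -> placement f' q' ->
  (total_size (supp q') <= #|edges f' q' :\: edges f q| +
     \sum_(A in shared_cliques q q') #|A :&: shared_vertices f f'|)%N.
Proof.
move=> pl pl'; rewrite -(card_edges pl').
have sub : shared_cliques q q' \subset supp q'.
  by apply/fintype.subsetP => A; rewrite inE => /andP[].
rewrite -(card_placed (shared_vertices f f') pl' sub).
rewrite -(cardsID (edges f q) (edges f' q')) addnC leq_add2l.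
apply: subset_leq_card; apply/fintype.subsetP => -[v z].
rewrite inE => /andP[/edgesP[A qA /imsetP[x xA ->]] /edgesP[B qB xB]].
rewrite inE /=; apply/exists_inP; exists A.
  rewrite inE; apply/andP; split; first by apply/suppP; exists z.
  rewrite qA -qB; apply: imset_f; by apply/suppP; exists z.
rewrite qA eqxx /= imset_f // inE xA inE.
by apply: (fintype.subsetP (imsetS f (finset.subsetT B))).
Qed.

End PlacementCounts.

(** * Union bounds for the bad events and for overlapping pairs *)

Section ErrorBounds.
Variables (R : realType) (T V W : finType) (p : R).
Hypothesis p01 : 0 <= p <= 1.
Implicit Types (C D : {set {set T}}) (S : {set T}).

Let p_ge0 : 0 <= p. Proof. by case/andP: p01. Qed.
Let p_le1 : p <= 1. Proof. by case/andP: p01. Qed.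

Lemma exprn_antitone m n : (m <= n)%N -> p ^+ n <= p ^+ m.
Proof. by move=> mn; rewrite ler_wiXn2l. Qed.

Lemma sum_imset_le (I J : finType) (h : I -> J) (A : {set I}) (phi : J -> R) :
  (forall j, 0 <= phi j) ->
  \sum_(j in h @: A) phi j <= \sum_(i in A) phi (h i).
Proof.
move=> phi0; rewrite (partition_big_imset h) /=; apply: ler_sum => _ /imsetP[i iA ->].
rewrite (bigD1 i) ?iA ?eqxx //= lerDl; exact: sumr_ge0.
Qed.

(** A first-moment bound for a sub-pattern instead of the whole pattern: [S] and [D] are at choice,
    so they can be taken where the exponent is negative. *)
Lemma prob_present_le C D S : D \subset C ->
  subset_prob p (fun G : {set V * W} => [exists a in placements_of V W C, edges a.1 a.2 \subset G])
  <= #|V|%:R ^+ #|S| * #|W|%:R ^+ #|D| * p ^+ (\sum_(A in D) #|A :&: S|).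
Proof.
move=> DC; set FF := [set placed a.1 a.2 S D | a in placements_of V W C].
apply: (@le_trans _ _ (subset_prob p (fun G : {set V * W} => [exists E in FF, E \subset G]))).
  apply: subset_prob_le => // G /exists_inP[a aC aG]; apply/exists_inP.
  exists (placed a.1 a.2 S D); first exact: imset_f.
  apply: fintype.subset_trans aG; apply/fintype.subsetP => -[v z].
  rewrite inE => /exists_inP[A AD /= /andP[/eqP qA vA]]; apply/edgesP; exists A => //.
  by apply: fintype.subsetP vA; apply: imsetS; exact: finset.subsetIl.
apply: le_trans (subset_prob_exists p01 _ _) _.
rewrite (eq_bigr (fun=> p ^+ (\sum_(A in D) #|A :&: S|))); last first.
  move=> _ /imsetP[a aC ->]; rewrite subset_prob_supset.
  by move: aC; rewrite inE => /andP[pl /eqP aC]; rewrite card_placed // aC.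
rewrite sumr_const -[leLHS]mulr_natl ler_wpM2r ?exprn_ge0 //.
by rewrite -!natrX -natrM ler_nat; exact: card_placed_image_le.
Qed.

Variable CC : {set {set {set T}}}.

Definition weight_sum : R := \sum_(a in placements V W CC) p ^+ total_size (supp a.2).

(** The object of the extra incidence is determined by the clique [A], so the union bound has
    constantly many terms per placement, each with one incidence more. *)
Lemma extra_edge_prob :
  subset_prob p (fun G : {set V * W} => ~~ no_extra_edge CC G) <=
  weight_sum * ((#|T| * #|{set T}|)%:R * p).
Proof.
pose P (a : {ffun T -> V} * {ffun {set T} -> option W}) (u : T * {set T}) (G : {set V * W}) :=
  [exists z, [&& a.2 u.2 == Some z, u.1 \notin u.2, edges a.1 a.2 \subset G & (a.1 u.1, z) \in G]].
apply: (@le_trans _ _ (subset_prob p (fun G : {set V * W} =>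
   [exists a in placements V W CC, [exists u in predT, P a u G]]))).
  apply: subset_prob_le => // G /forall_inPn[a aP].
  rewrite negb_imply => /andP[aG /forallPn[x /forallPn[A /forallPn[z]]]].
  rewrite !negb_imply => /and4P[qA xA xG _].
  apply/exists_inP; exists a => //; apply/existsP; exists (x, A) => /=.
  by apply/existsP; exists z; rewrite qA xA aG xG.
apply: le_trans (subset_prob_exists p01 _ _) _; rewrite /weight_sum big_distrl /=.
apply: ler_sum => a; rewrite inE => /andP[pl _].
apply: le_trans (subset_prob_exists p01 _ _) _.
apply: (@le_trans _ _ (\sum_(u : T * {set T}) p ^+ total_size (supp a.2) * p)); last first.
  by rewrite sumr_const card_prod -[leLHS]mulr_natl mulrCA.
apply: ler_sum => -[x A] _; rewrite -exprSr.
have [/existsP[z /andP[/eqP qA xA]]|no] :=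
  boolP [exists z, (a.2 A == Some z) && (x \notin A)]; last first.
  rewrite /subset_prob big_pred0 ?exprn_ge0 // => G.
  apply/negbTE; apply: contra no => /existsP[z /= /and4P[qA xA _ _]].
  by apply/existsP; exists z; rewrite qA.
have -> : (total_size (supp a.2)).+1 = #|(a.1 x, z) |: edges a.1 a.2|.
  rewrite cardsU1 (mem_edges _ pl qA) mem_imset ?(negPf xA) ?card_edges //.
  exact: placement_inj pl.
rewrite -subset_prob_supset; apply: subset_prob_le => // G /existsP[z' /= /and4P[]].
rewrite qA => /eqP[<-] _ aG xG; by rewrite finset.subUset finset.sub1set xG.
Qed.

(** The extra object is arbitrary in [W] and lies outside the pattern, so its two incidences are
    both new. *)
Lemma extra_object_prob :
  subset_prob p (fun G : {set V * W} => ~~ no_extra_object CC G) <=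
  weight_sum * ((#|T| * #|T|)%:R * (#|W|%:R * p ^+ 2)).
Proof.
pose P (a : {ffun T -> V} * {ffun {set T} -> option W}) (u : T * T * W) (G : {set V * W}) :=
  [&& ~~ [exists A, a.2 A == Some u.2], u.1.1 != u.1.2, edges a.1 a.2 \subset G,
    (a.1 u.1.1, u.2) \in G & (a.1 u.1.2, u.2) \in G].
apply: (@le_trans _ _ (subset_prob p (fun G : {set V * W} =>
   [exists a in placements V W CC, [exists u in predT, P a u G]]))).
  apply: subset_prob_le => // G /forall_inPn[a aP].
  rewrite negb_imply => /andP[aG /forallPn[z /forallPn[x /forallPn[y]]]].
  rewrite !negb_imply => /and5P[xy xG yG nA _].
  apply/exists_inP; exists a => //; apply/existsP; exists (x, y, z).
  by rewrite /P /= nA xy aG xG yG.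
apply: le_trans (subset_prob_exists p01 _ _) _; rewrite /weight_sum big_distrl /=.
apply: ler_sum => a; rewrite inE => /andP[pl _].
apply: le_trans (subset_prob_exists p01 _ _) _.
apply: (@le_trans _ _ (\sum_(u : T * T * W) p ^+ total_size (supp a.2) * p ^+ 2)); last first.
  by rewrite sumr_const !card_prod -[leLHS]mulr_natl mulrCA natrM !mulrA.
apply: ler_sum => -[[x y] z] _; rewrite -exprD addn2.
have [/andP[nA xy]|no] := boolP (~~ [exists A, a.2 A == Some z] && (x != y)); last first.
  rewrite /subset_prob big_pred0 ?exprn_ge0 // => G.
  by apply/negbTE; apply: contra no => /and5P[-> -> _ _ _].
have nE v : (v, z) \notin edges a.1 a.2.
  apply: contra nA => /edgesP[A qA _]; by apply/existsP; exists A; rewrite qA.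
have -> : (total_size (supp a.2)).+2 =
    #|(a.1 x, z) |: ((a.1 y, z) |: edges a.1 a.2)|.
  rewrite !cardsU1 nE in_setU1 (negPf (nE _)) orbF card_edges //.
  by rewrite xpair_eqE (inj_eq (placement_inj pl)) (negPf xy).
rewrite -subset_prob_supset; apply: subset_prob_le => // G /and5P[_ _ /= aG xG yG].
by rewrite !finset.subUset !finset.sub1set xG yG.
Qed.

(** Dominates the number of ways to identify the shared vertices and cliques with those of the first
    placement, for all [S] and [D] at once. *)
Definition overlap_const : R := (#|T| ^ #|T| * #|{set T}| ^ #|{set T}|)%:R.

(** If everything is shared, the general formula would be the constant 1; since the second edge set
    is required not to lie in the first, at least one incidence is new and [p] takes its place. The
    value 0 is for pairs [(S, D)] that overlapping patterns cannot produce. *)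
Definition overlap_bound C S D : R :=
  if (D \subset C) && (S != finset.set0) then
    overlap_const * (if (S == [set: T]%SET) && (D == C) then p else
      #|V|%:R ^+ (#|T| - #|S|) * #|W|%:R ^+ (#|C| - #|D|) *
        p ^+ (total_size C - \sum_(A in D) #|A :&: S|))
  else 0.

Lemma overlap_sum_of_le (a : {ffun T -> V} * {ffun {set T} -> option W}) C : placement a.1 a.2 ->
  \sum_(b in placements_of V W C | ~~ [disjoint edges a.1 a.2 & edges b.1 b.2] &&
      ~~ (edges b.1 b.2 \subset edges a.1 a.2))
    p ^+ #|edges b.1 b.2 :\: edges a.1 a.2| <= \sum_(S : {set T}) \sum_(D : {set {set T}}) overlap_bound C S D.
Proof.
move=> pla; rewrite pair_bigA /=.
rewrite (partition_big (fun b : {ffun T -> V} * {ffun {set T} -> option W} =>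
  (shared_vertices a.1 b.1, shared_cliques a.2 b.2)) predT) //=.
apply: ler_sum => -[S D] _ /=.
have [sub|nsub] := boolP ((D \subset C) && (S != finset.set0)); last first.
  rewrite big1 /overlap_bound ?(negPf nsub) // => b.
  move=> /andP[/andP[bC /andP[dis _]] /eqP[bS bD]]; case/negP: nsub.
  move: bC; rewrite inE => /andP[plb /eqP bC].
  apply/andP; split; first by rewrite -bD -bC; apply/fintype.subsetP => A; rewrite inE => /andP[].
  move: dis; rewrite -setI_eq0 => /finset.set0Pn[[v z]].
  rewrite inE => /andP[/edgesP[B _ vB] /edgesP[A _ /imsetP[x _ vx]]].
  apply/finset.set0Pn; exists x; rewrite -bS inE -vx.
  by apply: fintype.subsetP vB; apply: imsetS; exact: finset.subsetT.
rewrite /overlap_bound sub; case/andP: sub => DC S0.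
have T0 : (0 < #|T|)%N by case/finset.set0Pn: S0 => x _; apply/card_gt0P; exists x.
set M : R := if _ then _ else _.
have M0 : 0 <= #|V|%:R ^+ (#|T| - #|S|) * #|W|%:R ^+ (#|C| - #|D|) :> R.
  by rewrite mulr_ge0 // exprn_ge0.
pose cnt := (#|T| ^ #|S| * #|V| ^ (#|T| - #|S|) *
  (#|supp a.2| ^ #|D| * #|W| ^ (#|C| - #|D|)))%N.
have cnt_le : cnt%:R <= overlap_const *
    (#|V|%:R ^+ (#|T| - #|S|) * #|W|%:R ^+ (#|C| - #|D|)) :> R.
  rewrite -!natrX -!natrM ler_nat /cnt mulnACA leq_mul //; apply: leq_mul.
    by rewrite leq_pexp2l // max_card.
  have st0 : (0 < #|{set T}|)%N by apply/card_gt0P; exists S.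
  apply: (@leq_trans (#|{set T}| ^ #|D|)); first by case: #|D| => // k; rewrite leq_exp2r // max_card.
  by rewrite leq_pexp2l // max_card.
pose m := if (S == [set: T]%SET) && (D == C) then p else
   p ^+ (total_size C - \sum_(A in D) #|A :&: S|).
have m0 : 0 <= m by rewrite /m; case: ifP => // _; exact: exprn_ge0.
apply: (@le_trans _ _ (cnt%:R * m)).
  apply: (@le_trans _ _ (\sum_(b in [set b in placements_of V W C |
      (shared_vertices a.1 b.1 == S) && (shared_cliques a.2 b.2 == D)]) m)); last first.
    by rewrite sumr_const -[leLHS]mulr_natl ler_wpM2r // ler_nat; exact: card_overlap_le.
  rewrite [leRHS]big_mkcond [leLHS]big_mkcond; apply: ler_sum => b _.
  rewrite [b \in [set _ in _ | _]]inE xpair_eqE.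
  case: ifP => [/andP[/andP[bC /andP[_ nsub]] /andP[/eqP bS /eqP bD]]|_]; last by case: ifP.
  rewrite bC bS bD !eqxx /=.
  move: bC; rewrite inE => /andP[plb /eqP bC].
  rewrite /m; case: ifP => _.
    rewrite -[leRHS]expr1; apply: exprn_antitone.
    by rewrite card_gt0 finset.setD_eq0.
  apply: exprn_antitone; rewrite leq_subLR -bC -bS -bD addnC; exact: card_edges_setD.
apply: le_trans (ler_wpM2r m0 cnt_le) _; rewrite -mulrA ler_wpM2l ?ler0n //.
rewrite /m /M; case: ifP => // /andP[/eqP -> /eqP ->].
by rewrite cardsT !subnn !expr0 !mul1r.
Qed.

Definition overlap_total : R := \sum_(C in CC) \sum_(S : {set T}) \sum_(D : {set {set T}}) overlap_bound C S D.

Lemma overlap_sum_le (a : {ffun T -> V} * {ffun {set T} -> option W}) : placement a.1 a.2 ->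
  \sum_(b in placements V W CC | ~~ [disjoint edges a.1 a.2 & edges b.1 b.2] &&
      ~~ (edges b.1 b.2 \subset edges a.1 a.2))
    p ^+ #|edges b.1 b.2 :\: edges a.1 a.2| <= overlap_total.
Proof.
move=> pla.
rewrite (partition_big (fun b : {ffun T -> V} * {ffun {set T} -> option W} => supp b.2)
  (mem CC)) /=; last by move=> b /andP[]; rewrite inE => /andP[].
apply: ler_sum => C CiCC; apply: le_trans (overlap_sum_of_le C pla).
rewrite le_eqVlt; apply/orP; left; apply/eqP; apply: eq_bigl => b; rewrite !inE.
have [->|_] := eqVneq (supp b.2) C; last by rewrite !andbF.
by rewrite CiCC !andbT.
Qed.

Hypothesis CC_pos : forall C, C \in CC -> (0 < total_size C)%N.

Lemma mean_subsets_le_weight :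
  mean_subsets p [set edges a.1 a.2 | a in placements V W CC] <= weight_sum.
Proof.
apply: (le_trans (@sum_imset_le _ _ _ _ (fun E : {set V * W} => p ^+ #|E|) _)).
  by move=> E; rewrite exprn_ge0.
by apply: ler_sum => a; rewrite inE => /andP[pl _]; rewrite card_edges.
Qed.

Lemma overlap_error_le :
  overlap_error p [set edges a.1 a.2 | a in placements V W CC] <=
  weight_sum * (p + 2 * overlap_total).
Proof.
set F := [set edges a.1 a.2 | a in _].
rewrite /overlap_error big_split /= mulrDr; apply: lerD.
  rewrite mulrC; apply: le_trans (ler_wpM2l p_ge0 mean_subsets_le_weight).
  rewrite /mean_subsets big_distrr /=; apply: ler_sum => _ /imsetP[a aP ->].
  move: aP; rewrite inE => /andP[pl aC]; rewrite ler_wpM2r ?exprn_ge0 //.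
  by rewrite -[leRHS]expr1 exprn_antitone // card_edges // CC_pos.
(* For [E' \subset E] the factor [p ^+ #|E' :\: E|] is 1, so such pairs are left out of [phi]. The
   product [p ^+ #|E| * p ^+ #|E' :\: E|] is symmetric in the two sets, and distinct sets cannot
   contain each other, so [phi E E' + phi E' E] covers every pair. This is the origin of the factor
   2. *)
pose phi (E E' : {set V * W}) : R := if ~~ [disjoint E & E'] && ~~ (E' \subset E)
  then p ^+ #|E| * p ^+ #|E' :\: E| else 0.
have phi0 E E' : 0 <= phi E E'.
  by rewrite /phi; case: ifP => // _; rewrite mulr_ge0 ?exprn_ge0.
have union (E E' : {set V * W}) : p ^+ #|E| * p ^+ #|E' :\: E| = p ^+ #|E :|: E'|.
  by rewrite -exprD cardsU cardsD finset.setIC addnBA // subset_leq_card // finset.subsetIr.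
have half : \sum_(E in F) \sum_(E' in F) phi E E' <= weight_sum * overlap_total.
  apply: (@le_trans _ _ (\sum_(a in placements V W CC) \sum_(b in placements V W CC)
     phi (edges a.1 a.2) (edges b.1 b.2))).
    apply: (@le_trans _ _ (\sum_(a in placements V W CC) \sum_(E' in F) phi (edges a.1 a.2) E')).
      apply: (@sum_imset_le _ _ _ _ (fun E => \sum_(E' in F) phi E E')) => E.
      by apply: sumr_ge0.
    by apply: ler_sum => a _; apply: sum_imset_le.
  rewrite /weight_sum big_distrl /=; apply: ler_sum => a; rewrite inE => /andP[pl _].
  rewrite /phi -big_mkcondr /= -big_distrr /= card_edges // ler_wpM2l ?exprn_ge0 //.
  exact: overlap_sum_le.
apply: (@le_trans _ _ (\sum_(E in F) \sum_(E' in F) (phi E E' + phi E' E))) ; last first.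
  under eq_bigr do rewrite big_split /=.
  rewrite big_split /= [X in _ + X]exchange_big /= mulrCA mulr_natl mulr2n.
  exact: lerD.
apply: ler_sum => E _; rewrite [leLHS]big_mkcondr; apply: ler_sum => E' _.
case: ifP => [/andP[EE' dis]|_]; last by rewrite addr_ge0.
rewrite /phi [[disjoint E' & E]]disjoint_sym dis /=.
have [E'E|_] := boolP (E' \subset E); last by rewrite lerDl; case: ifP => // _; rewrite mulr_ge0 ?exprn_ge0.
have -> : E \subset E' = false.
  by apply/negP => sEE'; case/negP: EE'; rewrite finset.eqEsubset E'E.
by rewrite add0r !union finset.setUC.
Qed.

End ErrorBounds.

(** * Limits *)

Local Open Scope classical_set_scope.

Section PoissonLimit.
Variable R : realType.
Implicit Types (u v : nat -> R).

Lemma cvg_sum_seq (I : Type) (r : seq I) (P : pred I) (u : I -> nat -> R) (l : I -> R) :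
  (forall i, P i -> u i @ \oo --> l i) ->
  (fun n => \sum_(i <- r | P i) u i n) @ \oo --> \sum_(i <- r | P i) l i.
Proof.
move=> ul; elim: r => [|i r IH].
  by under eq_fun do rewrite big_nil; rewrite big_nil; exact: cvg_cst.
under eq_fun do rewrite big_cons; rewrite big_cons.
by case: ifP => [/ul uil|_] //; exact: cvgD.
Qed.

Lemma squeeze_norm0 u v : (\forall n \near \oo, `|u n| <= v n) ->
  v @ \oo --> 0 -> u @ \oo --> 0.
Proof.
move=> uv v0; apply: norm_cvg0; apply: squeeze_cvgr v0; last exact: cvg_cst.
by apply: filterS uv => n ->; rewrite normr_ge0.
Qed.

Definition poisson_weight (lambda : R) k : R :=
  expR (- lambda) * lambda ^+ k / (k`!)%:R.

Definition exp_partial (lambda : R) K : R := \sum_(0 <= k < K) lambda ^+ k / (k`!)%:R.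

Lemma cvg_exp_partial lambda : exp_partial lambda @ \oo --> expR lambda.
Proof. exact: is_cvg_series_exp_coeff. Qed.

Lemma exp_partial_le lambda K : 0 <= lambda -> exp_partial lambda K <= expR lambda.
Proof.
move=> l0; apply: (nondecreasing_cvgn_le (u_ := exp_partial lambda)).
  apply: nondecreasing_series => n _ _; exact: (exp_coeff_ge0 n l0).
exact: is_cvg_series_exp_coeff.
Qed.

Lemma poisson_weight_sum lambda K :
  \sum_(0 <= k < K) poisson_weight lambda k = expR (- lambda) * exp_partial lambda K.
Proof. by rewrite /exp_partial big_distrr; apply: eq_bigr => k _; rewrite /= mulrA. Qed.

Lemma poisson_weight_ge0 lambda k : 0 <= lambda -> 0 <= poisson_weight lambda k.
Proof. by move=> l0; rewrite !mulr_ge0 ?expR_ge0 ?exprn_ge0 ?invr_ge0. Qed.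

Section Recursion.
Variables (g : nat -> nat -> R) (eps lam : nat -> R) (lambda : R).
Hypothesis lambda_ge0 : 0 <= lambda.
Hypothesis g_ge0 : \forall n \near \oo, forall k, 0 <= g n k.
Hypothesis g_sum_le1 : \forall n \near \oo, forall K, \sum_(0 <= k < K) g n k <= 1.
Hypothesis g_tail : \forall n \near \oo, forall K,
  K%:R * (1 - \sum_(0 <= k < K) g n k) <= lam n.
Hypothesis g_recursion : \forall n \near \oo, forall k,
  `|k.+1%:R * g n k.+1 - lam n * g n k| <= eps n.
Hypothesis lam_cvg : lam @ \oo --> lambda.
Hypothesis eps_cvg : eps @ \oo --> 0.

Let g_le1 : \forall n \near \oo, forall k, g n k <= 1.
Proof.
near=> n => k.
have g0 : forall k, 0 <= g n k by near: n.
have /(_ k.+1) : forall K, \sum_(0 <= k < K) g n k <= 1 by near: n.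
apply: le_trans; rewrite big_nat_recr //= lerDr; exact: sumr_ge0.
Unshelve. all: end_near. Qed.

(** For each fixed [k] the recursion can be iterated from 0 with finitely many vanishing errors; it
    yields the ratios to [g n 0] and leaves [g n 0] itself open. *)
Lemma recursion_ratio k :
  (fun n => g n k - lambda ^+ k / (k`!)%:R * g n 0%N) @ \oo --> 0.
Proof.
elim: k => [|k IH].
  by under eq_fun do rewrite expr0 fact0 divr1 mul1r subrr; exact: cvg_cst.
pose v n := eps n + `|lam n - lambda| +
  lambda * `|g n k - lambda ^+ k / (k`!)%:R * g n 0%N|.
apply: (@squeeze_norm0 _ v).
  near=> n.
  have /(_ k) g0 : forall k, 0 <= g n k by near: n.
  have /(_ k) g1 : forall k, g n k <= 1 by near: n.
  have /(_ k) rec : forall k, `|k.+1%:R * g n k.+1 - lam n * g n k| <= eps n by near: n.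
  have k1 : (1 : R) <= k.+1%:R by rewrite ler1n.
  rewrite -[leLHS]mul1r; apply: (@le_trans _ _ (k.+1%:R * `|g n k.+1 -
    lambda ^+ k.+1 / (k.+1)`!%:R * g n 0%N|)); first exact: ler_wpM2r.
  rewrite -[X in X * _](@ger0_norm _ k.+1%:R) // -normrM.
  have -> : k.+1%:R * (g n k.+1 - lambda ^+ k.+1 / (k.+1)`!%:R * g n 0%N) =
    (k.+1%:R * g n k.+1 - lam n * g n k) + (lam n - lambda) * g n k +
    lambda * (g n k - lambda ^+ k / (k`!)%:R * g n 0%N).
    rewrite factS natrM exprS; field.
    by rewrite ?pnatr_eq0 -?lt0n ?fact_gt0 //= -natr1 ?natr1 pnatr_eq0.
  apply: le_trans (ler_normD _ _) _; rewrite /v lerD //; last first.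
    by rewrite normrM (ger0_norm lambda_ge0).
  apply: le_trans (ler_normD _ _) _; rewrite lerD //.
  by rewrite normrM -[leRHS]mulr1 ler_wpM2l // ger0_norm.
rewrite /v -[X in _ --> X](_ : 0 + 0 + lambda * 0 = 0); last by rewrite mulr0 !addr0.
apply: cvgD; last first.
  apply: cvgM; first exact: cvg_cst.
  by rewrite -[X in _ --> X](normr0 R); exact: cvg_norm.
apply: cvgD => //; rewrite -[X in _ --> X](normr0 R); apply: cvg_norm.
rewrite -[X in _ --> X](subrr lambda); apply: cvgB => //; exact: cvg_cst.
Unshelve. all: end_near. Qed.

(** The first [K] masses sum to nearly 1 by the tail bound and to nearly
    [exp_partial lambda K * g n 0] by the ratios, which pins down [g n 0]. *)
Lemma recursion_cvg0 : (fun n => g n 0%N) @ \oo --> expR (- lambda).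
Proof.
suff h : (fun n => expR lambda * g n 0%N) @ \oo --> (1 : R).
  rewrite -[X in _ --> X]mulr1.
  rewrite (_ : (fun n => g n 0%N) = (fun n => expR (- lambda) * (expR lambda * g n 0%N))).
    by apply: cvgM h; exact: cvg_cst.
  by apply/funext => n; rewrite mulrA -expRD addNr expR0 mul1r.
apply/cvgrPdist_le => e e0.
have e4 : 0 < e / 4 by rewrite divr_gt0.
(* [K] is fixed before [n]. It makes the missing mass, at most [lam n / K] with
   [lam n <= lambda + 1] eventually, and the truncation error of the exponential series each at most
   [e / 4]; the [K] ratio errors together add a third [e / 4]. *)
have [K [K0 K1 K2]] : exists K, [/\ (0 < K)%N, lambda + 1 <= K%:R * (e / 4) &
    `|expR lambda - exp_partial lambda K| <= e / 4].
  near \oo => K; exists K; split.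
  - by near: K; exact: nbhs_infty_gt.
  - by rewrite -ler_pdivrMr //; near: K; exact: nbhs_infty_ger.
  - by near: K; move/cvgrPdist_le: (@cvg_exp_partial lambda); exact.
have hK : (fun n => \sum_(0 <= k < K) (g n k - lambda ^+ k / (k`!)%:R * g n 0%N))
    @ \oo --> (0 : R).
  rewrite [X in _ --> X](_ : 0 = \sum_(0 <= k < K) 0); last by rewrite big1.
  by apply: cvg_sum_seq => k _; exact: recursion_ratio.
near=> n.
have /(_ 0%N) g0 : forall k, 0 <= g n k by near: n.
have /(_ 0%N) g1 : forall k, g n k <= 1 by near: n.
have /(_ K) t : forall K, K%:R * (1 - \sum_(0 <= k < K) g n k) <= lam n by near: n.
have /(_ K) s1 : forall K, \sum_(0 <= k < K) g n k <= 1 by near: n.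
have l1 : lam n <= lambda + 1.
  near: n; move/cvgrPdist_le: lam_cvg => /(_ _ ltr01); apply: filterS => n.
  by rewrite distrC => /(le_trans (ler_norm _)); rewrite lerBlDl addrC addrC.
have hn : `|\sum_(0 <= k < K) (g n k - lambda ^+ k / (k`!)%:R * g n 0%N)| <= e / 4.
  by near: n; exact: cvgr0_norm_le.
rewrite sumrB -big_distrl /= -/(exp_partial lambda K) in hn.
have t' : 1 - \sum_(0 <= k < K) g n k <= e / 4.
  rewrite -(@ler_pM2l _ K%:R) ?ltr0n //.
  exact: le_trans t (le_trans l1 K1).
have pl := @exp_partial_le lambda K lambda_ge0.
have d : 0 <= (expR lambda - exp_partial lambda K) * g n 0%N <= e / 4.
  rewrite mulr_ge0 ?subr_ge0 //=; apply: le_trans K2.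
  apply: le_trans (ler_norm _).
  by rewrite -[leRHS]mulr1 ler_wpM2l ?subr_ge0.
move: hn d; rewrite mulrBl ler_norml ler_norml => /andP[h1 h2] /andP[d1 d2].
apply/andP; split; lra.
Unshelve. all: end_near. Qed.

Lemma recursion_cvg k : (fun n => g n k) @ \oo --> poisson_weight lambda k.
Proof.
rewrite (_ : (fun n => g n k) = (fun n => (g n k - lambda ^+ k / (k`!)%:R * g n 0%N) +
    lambda ^+ k / (k`!)%:R * g n 0%N)); last by apply/funext => n; rewrite subrK.
rewrite [X in _ --> X](_ : _ = 0 + lambda ^+ k / (k`!)%:R * expR (- lambda)); last first.
  by rewrite add0r mulrC mulrA.
apply: cvgD.
  exact: recursion_ratio.
by apply: cvgM; [exact: cvg_cst | exact: recursion_cvg0].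
Qed.

End Recursion.

(** Scheffé's argument: as [f n] has mass at most 1, its tail beyond [K] is at most 1 minus its
    head, and the head is close to the Poisson head, which carries almost all of the Poisson
    mass. *)
Lemma dTV_poisson_cvg0 (f : nat -> nat -> R) lambda : 0 <= lambda ->
  (\forall n \near \oo, forall k, 0 <= f n k) ->
  (\forall n \near \oo, forall K, \sum_(0 <= k < K) f n k <= 1) ->
  (forall k, (fun n => f n k) @ \oo --> poisson_weight lambda k) ->
  (fun n => dTV_poisson (f n) lambda) @ \oo --> (0%E : \bar R).
Proof.
move=> l0 f_ge0 f_sum_le1 f_cvg.
have pi_le1 K : \sum_(0 <= k < K) poisson_weight lambda k <= 1.
  rewrite poisson_weight_sum -(expR0 R) -(addNr lambda) expRD.
  by rewrite ler_wpM2l ?expR_ge0 // exp_partial_le.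
have bound e : 0 < e -> \forall n \near \oo, (0 <= dTV_poisson (f n) lambda <= e%:E)%E.
  move=> e0; have e4 : 0 < e / 4 by rewrite divr_gt0.
  have [K hK] : exists K, 1 - \sum_(0 <= k < K) poisson_weight lambda k <= e / 4.
    have : (fun K => expR (- lambda) * exp_partial lambda K) @ \oo --> (1 : R).
      rewrite -(expR0 R) -(addNr lambda) expRD.
      by apply: cvgM; [exact: cvg_cst | exact: cvg_exp_partial].
    move/cvgrPdist_le/(_ _ e4) => h; near \oo => K; exists K.
    by rewrite poisson_weight_sum; apply: le_trans (ler_norm _) _; near: K.
  have dK : (fun n => \sum_(0 <= k < K) `|f n k - poisson_weight lambda k|) @ \oo --> (0 : R).
    rewrite [X in _ --> X](_ : 0 = \sum_(0 <= k < K) 0); last by rewrite big1.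
    apply: cvg_sum_seq => k _; rewrite -[X in _ --> X](normr0 R); apply: cvg_norm.
    by rewrite -[X in _ --> X](subrr (poisson_weight lambda k)); apply: cvgB => //; exact: cvg_cst.
  near=> n.
  have f0 : forall k, 0 <= f n k by near: n.
  have f1 : forall M, \sum_(0 <= k < M) f n k <= 1 by near: n.
  have dn : `|\sum_(0 <= k < K) `|f n k - poisson_weight lambda k| | <= e / 4.
    by near: n; exact: cvgr0_norm_le.
  rewrite ger0_norm in dn; last by apply: sumr_ge0.
  rewrite /dTV_poisson -/(poisson_weight lambda).
  apply/andP; split.
    by rewrite mule_ge0 // nneseries_ge0 // => k _ _; rewrite lee_fin.
  have -> : e = 2^-1 * (2 * e) by rewrite mulrA mulVf ?mul1r // pnatr_eq0.
  rewrite EFinM lee_pmul2l ?lte_fin //; apply: lime_le.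
    by apply: is_cvg_nneseries => k _ _; rewrite lee_fin.
  near=> M.
  have KM : (K <= M)%N by near: M; exact: nbhs_infty_ge.
  rewrite sumEFin lee_fin (big_cat_nat (leq0n K) KM) //=.
  have tail : \sum_(K <= k < M) `|f n k - poisson_weight lambda k| <=
     \sum_(K <= k < M) f n k + \sum_(K <= k < M) poisson_weight lambda k.
    rewrite -big_split /=; apply: ler_sum => k _; apply: le_trans (ler_normB _ _) _.
    by rewrite !ger0_norm // poisson_weight_ge0.
  have := f1 M; have := pi_le1 M; rewrite !(big_cat_nat (leq0n K) KM) //= => p1 f1'.
  have : \sum_(0 <= k < K) poisson_weight lambda k - \sum_(0 <= k < K) f n k <= e / 4.
    rewrite -sumrB; apply: le_trans dn; apply: ler_sum => k _.
    by rewrite distrC; exact: ler_norm.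
  by lra.
apply/fine_cvgP; split.
  by apply: filterS (bound 1 ltr01) => n /andP[d0 d1]; rewrite ge0_fin_numE // (le_lt_trans d1) // ltry.
apply/cvgr0Pnorm_le => e e0; apply: filterS (bound e e0) => n /andP[d0 d1] /=.
rewrite ger0_norm ?fine_ge0 // -lee_fin fineK //.
by rewrite ge0_fin_numE // (le_lt_trans d1) // ltry.
Unshelve. all: end_near. Qed.

End PoissonLimit.

(** * Powers of $n$, the number of objects, and expected counts *)

Section Growth.
Variable R : realType.

Lemma cvg_natpowR0 (b : R) : b < 0 -> (fun n => n%:R `^ b) @ \oo --> (0 : R).
Proof.
move=> b0; apply/cvgr0Pnorm_le => eps eps0; near=> n.
have n0 : (0 : R) < n%:R by rewrite ltr0n; near: n; exact: nbhs_infty_gt.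
rewrite ger0_norm ?powR_ge0 // -[b]opprK powRN -[leRHS]invrK.
rewrite lef_pV2 ?posrE ?powR_gt0 ?invr_gt0 //.
have e1 : (eps^-1 `^ (- b)^-1) `^ (- b) = eps^-1.
  by rewrite -powRrM mulVf ?powRr1 ?invr_ge0 ?ltW // oppr_eq0 lt_eqF.
rewrite -e1; apply: ge0_ler_powR; rewrite ?nnegrE ?powR_ge0 ?oppr_ge0 ?(ltW b0) //.
by near: n; exact: nbhs_infty_ger.
Unshelve. all: end_near. Qed.

Variables (alpha eta c : R) (m : nat -> nat) (p : nat -> R).
Hypotheses (alpha_gt0 : 0 < alpha) (c_gt0 : 0 < c).
Hypothesis hm : forall n, m n = Num.truncn (n%:R `^ alpha).
Hypothesis hp : forall n, (0 < n)%N -> p n = c * n%:R `^ (- eta).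

Lemma objects_le n : (m n)%:R <= n%:R `^ alpha.
Proof. by rewrite hm truncn_le powR_ge0. Qed.

Lemma objects_ratio : (fun n => (m n)%:R / n%:R `^ alpha) @ \oo --> (1 : R).
Proof.
apply: (@squeeze_cvgr _ _ _ _ (fun n => 1 - n%:R `^ (- alpha)) (fun=> 1)).
- near=> n.
  have n0 : (0 : R) < n%:R by rewrite ltr0n; near: n; exact: nbhs_infty_gt.
  have na : 0 < n%:R `^ alpha by rewrite powR_gt0.
  rewrite ler_pdivrMr // mul1r objects_le andbT powRN ler_pdivlMr //.
  rewrite mulrBl mul1r mulVf ?gt_eqF // lerBlDr natr1 hm.
  by apply/ltW; exact: truncnS_gt.
- rewrite -[X in _ --> X]subr0; apply: cvgB; first exact: cvg_cst.
  by apply: cvg_natpowR0; rewrite oppr_lt0.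
- exact: cvg_cst.
Unshelve. all: end_near. Qed.

Lemma powR_combine n (a b s : nat) : (0 < n)%N ->
  n%:R ^+ a * (n%:R `^ alpha) ^+ b * (n%:R `^ (- eta)) ^+ s
  = n%:R `^ (a%:R + alpha * b%:R - eta * s%:R) :> R.
Proof.
move=> n0; have nn : (n%:R : R) != 0 by rewrite pnatr_eq0 -lt0n.
rewrite -!powR_mulrn ?powR_ge0 // -!powRrM -!powRD ?nn ?implybT //.
by rewrite mulNr.
Qed.

Lemma count_le n (a b s : nat) : (0 < n)%N ->
  n%:R ^+ a * (m n)%:R ^+ b * p n ^+ s <=
  c ^+ s * n%:R `^ (a%:R + alpha * b%:R - eta * s%:R).
Proof.
move=> n0; rewrite -powR_combine // hp // exprMn mulrCA ler_wpM2l ?exprn_ge0 ?(ltW c_gt0) //.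
rewrite ler_wpM2r ?exprn_ge0 ?powR_ge0 // ler_wpM2l ?exprn_ge0 //.
by rewrite lerXn2r ?nnegrE ?powR_ge0 // objects_le.
Qed.

Lemma p_ge0 n : (0 < n)%N -> 0 <= p n.
Proof. by move=> n0; rewrite hp // mulr_ge0 ?powR_ge0 // ltW. Qed.

Lemma count_cvg0 (a b s : nat) : a%:R + alpha * b%:R - eta * s%:R < 0 ->
  (fun n => n%:R ^+ a * (m n)%:R ^+ b * p n ^+ s) @ \oo --> (0 : R).
Proof.
move=> neg; apply: (@squeeze_norm0 _ _ (fun n => c ^+ s *
   n%:R `^ (a%:R + alpha * b%:R - eta * s%:R))).
  near=> n; have n0 : (0 < n)%N by near: n; exact: nbhs_infty_gt.
  by rewrite ger0_norm ?count_le // !mulr_ge0 ?exprn_ge0 ?p_ge0.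
rewrite -[X in _ --> X](mulr0 (c ^+ s)); apply: cvgM; first exact: cvg_cst.
exact: cvg_natpowR0.
Unshelve. all: end_near. Qed.

Lemma ffact_ratio (u : nat -> nat) (b : R) k : 0 < b ->
  (fun n => (u n)%:R / n%:R `^ b) @ \oo --> (1 : R) ->
  (fun n => (u n ^_ k)%:R / (n%:R `^ b) ^+ k) @ \oo --> (1 : R).
Proof.
move=> b0 u1; elim: k => [|k IH].
  by under eq_fun do rewrite ffactn0 expr0 divr1; exact: cvg_cst.
rewrite [X in _ --> X](_ : (1 : R) = 1 * (1 - 0)); last by rewrite subr0 mulr1.
apply: (@cvg_trans _ ((fun n => ((u n ^_ k)%:R / (n%:R `^ b) ^+ k) *
   ((u n)%:R / n%:R `^ b - k%:R * n%:R `^ (- b))) @ \oo)); last first.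
  apply: cvgM => //; apply: cvgB => //; rewrite -[X in _ --> X](mulr0 k%:R).
  by apply: cvgM; [exact: cvg_cst | apply: cvg_natpowR0; rewrite oppr_lt0].
apply: near_eq_cvg; near=> n.
have n0 : (0 : R) < n%:R by rewrite ltr0n; near: n; exact: nbhs_infty_gt.
have nb : 0 < n%:R `^ b by rewrite powR_gt0.
rewrite ffactnSr natrM exprSr invfM mulrACA powRN -mulrBl; congr (_ * (_ * _)).
have [ku|uk] := leqP k (u n); first by rewrite natrB.
(* If [u n < k], the truncated difference [u n - k] would not be the real one. For large [n] this
   cannot happen: [u n] exceeds half of the normalisation, while [k] stays below half of it. *)
suff : (u n)%:R / n%:R `^ b > (k%:R / n%:R `^ b : R).
  by rewrite ltr_pM2r ?invr_gt0 // ltr_nat ltnNge (ltnW uk).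
apply: (@lt_trans _ _ (1 / 2)).
  rewrite -powRN; near: n.
  have h : (fun n => k%:R * n%:R `^ (- b)) @ \oo --> (0 : R).
    rewrite -[X in _ --> X](mulr0 k%:R).
    by apply: cvgM; [exact: cvg_cst | apply: cvg_natpowR0; rewrite oppr_lt0].
  have /cvgrPdist_lt/(_ (1/2)) := h; rewrite divr_gt0 // => /(_ isT).
  by apply: filterS => n; rewrite sub0r normrN => /(le_lt_trans (ler_norm _)).
near: n; have /cvgrPdist_lt/(_ (1/2)) := u1; rewrite divr_gt0 // => /(_ isT).
apply: filterS => n /(le_lt_trans (ler_norm _)); lra.
Unshelve. all: end_near. Qed.

(** The two bounds on [u] agree to leading order, and at exponent 0 the powers of [n] cancel,
    leaving [c ^+ s]. *)
Lemma placements_count_cvg (a b s : nat) (u : nat -> nat) :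
  a%:R + alpha * b%:R - eta * s%:R = 0 ->
  (forall n, (n ^_ a * m n ^_ b <= u n)%N) -> (forall n, (u n <= n ^ a * m n ^ b)%N) ->
  (fun n => (u n)%:R * p n ^+ s) @ \oo --> c ^+ s.
Proof.
move=> zero lo up.
have ratio_n : (fun n : nat => n%:R / n%:R `^ 1) @ \oo --> (1 : R).
  apply: (@cvg_trans _ ((fun=> 1 : R) @ \oo)); last exact: cvg_cst.
  apply: near_eq_cvg; near=> n; rewrite powRr1 // divff // pnatr_eq0 -lt0n.
  by near: n; exact: nbhs_infty_gt.
apply: (@squeeze_cvgr _ _ _ _
   (fun n => c ^+ s * ((n ^_ a)%:R / (n%:R `^ 1) ^+ a * ((m n ^_ b)%:R / (n%:R `^ alpha) ^+ b)))
   (fun=> c ^+ s)).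
- near=> n; have n0 : (0 < n)%N by near: n; exact: nbhs_infty_gt.
  have nR : (0 : R) < n%:R by rewrite ltr0n.
  have nn : (n%:R : R) != 0 by rewrite gt_eqF.
  have na : n%:R `^ alpha != 0 by rewrite gt_eqF ?powR_gt0.
  have id1 : n%:R ^+ a * (n%:R `^ alpha) ^+ b * (n%:R `^ (- eta)) ^+ s = 1 :> R.
    by rewrite powR_combine // zero powRr0.
  apply/andP; split; last first.
    apply: (@le_trans _ _ (n%:R ^+ a * (m n)%:R ^+ b * p n ^+ s)).
      by rewrite ler_wpM2r ?exprn_ge0 ?p_ge0 // -!natrX -natrM ler_nat up.
    by apply: le_trans (count_le a b s n0) _; rewrite zero powRr0 mulr1.
  apply: (@le_trans _ _ ((n ^_ a * m n ^_ b)%:R * p n ^+ s)); last first.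
    by rewrite ler_wpM2r ?exprn_ge0 ?p_ge0 // ler_nat lo.
  have -> : p n ^+ s = c ^+ s * ((n%:R ^+ a)^-1 * ((n%:R `^ alpha) ^+ b)^-1).
    rewrite hp // exprMn; congr (_ * _).
    rewrite -invfM -[LHS]mul1r -[X in X * _](mulVf (mulf_neq0 (expf_neq0 a nn) (expf_neq0 b na))).
    by rewrite -mulrA id1 mulr1.
  by rewrite powRr1 // natrM mulrCA le_eqVlt; apply/orP; left; apply/eqP; ring.
- rewrite [X in _ --> X](_ : c ^+ s = c ^+ s * (1 * 1)); last by rewrite !mulr1.
  apply: cvgM; first exact: cvg_cst.
  apply: cvgM; first exact: (ffact_ratio (u := id)).
  by apply: ffact_ratio => //; exact: objects_ratio.
- exact: cvg_cst.
Unshelve. all: end_near. Qed.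

(** Otherwise [m n * p n ^+ 2] would be at least [c ^+ 2 * (m n / n ^ alpha)] for large [n], which
    tends to [c ^+ 2 > 0]. *)
Lemma alpha_lt_double : (fun n => (m n)%:R * p n ^+ 2) @ \oo --> (0 : R) -> alpha < 2 * eta.
Proof.
move=> h; rewrite ltNge; apply/negP => le.
suff : c ^+ 2 <= 0 by rewrite leNgt exprn_gt0.
have h1 : (fun n => c ^+ 2 * ((m n)%:R / n%:R `^ alpha)) @ \oo --> c ^+ 2.
  rewrite -[X in _ --> X]mulr1; apply: cvgM; first exact: cvg_cst.
  exact: objects_ratio.
apply: (ler_cvg_to h1 h); near=> n.
have n0 : (0 < n)%N by near: n; exact: nbhs_infty_gt.
have n1 : (1 : R) <= n%:R by rewrite ler1n.
have c2 : 0 <= c ^+ 2 by rewrite exprn_ge0 // ltW.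
rewrite hp // exprMn mulrCA ler_wpM2l ?exprn_ge0 ?(ltW c_gt0) // ler_wpM2l //.
rewrite -powR_mulrn ?powR_ge0 // -powRrM -powRN; apply: ler_powR => //; lra.
Unshelve. all: end_near. Qed.

End Growth.

(** * Convergence to the Poisson law *)

Section Assembly.
Variables (R : realType) (T : finType) (e : rel T).
Hypothesis (e_sym : symmetric e) (e_irr : irreflexive e).
Hypothesis hedge : exists x y, e x y.
Variables (alpha c : R) (m : nat -> nat) (p : nat -> R).
Hypotheses (alpha_gt0 : 0 < alpha) (c_gt0 : 0 < c).
Let eta : R := fine (eta0 e alpha).
Hypothesis hm : forall n, m n = Num.truncn (n%:R `^ alpha).
Hypothesis hp : forall n, (0 < n)%N -> p n = c * n%:R `^ (- eta).
Hypothesis hmp : (fun n => (m n)%:R * p n ^+ 2) @ \oo --> (0 : R).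
Hypothesis hbal : strictly_balanced e alpha.

Let CC := optimal_covers e alpha.

Let alpha_lt : alpha < 2 * eta.
Proof. exact: alpha_lt_double alpha_gt0 c_gt0 hm hp hmp. Qed.

Let CC_proper C : C \in CC -> C \in proper_covers e.
Proof. exact: optimal_proper. Qed.

Let CC_pos C : C \in CC -> (0 < total_size C)%N.
Proof.
have [x [y exy]] := hedge.
by move=> /CC_proper Cp; exact: proper_cover_total_gt0 Cp exy.
Qed.

Let eta_gt0 : 0 < eta.
Proof. by move: alpha_gt0 alpha_lt => ? ?; lra. Qed.

Let near_gt0 : \forall n \near \oo, (0 < n)%N.
Proof. exact: nbhs_infty_gt. Qed.

Let p_cvg0 : p @ \oo --> (0 : R).
Proof.
have := count_cvg0 (a := 0) (b := 0) (s := 1) c_gt0 hm hp.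
rewrite mulr0 mulr1 add0r add0r oppr_lt0 => /(_ eta_gt0).
by under eq_fun do rewrite !expr0 !mul1r expr1.
Qed.

Let near_p : \forall n \near \oo, 0 <= p n <= 1.
Proof.
near=> n; have n0 : (0 < n)%N by near: n.
rewrite (p_ge0 c_gt0 hp n0) /=.
apply: le_trans (ler_norm _) _; near: n.
by apply: cvgr0_norm_le; [exact: p_cvg0 | exact: ltr01].
Unshelve. all: end_near. Qed.

Let ws n := weight_sum 'I_n 'I_(m n) (p n) CC.

Let weight_sumE n : ws n =
  \sum_(C in CC) #|placements_of 'I_n 'I_(m n) C|%:R * p n ^+ total_size C.
Proof.
rewrite /ws /weight_sum (partition_big (fun b : {ffun T -> 'I_n} *
  {ffun {set T} -> option 'I_(m n)} => supp b.2) (mem CC)) /=; last first.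
  by move=> b; rewrite inE => /andP[].
apply: eq_bigr => C CiCC; rewrite (eq_bigr (fun=> p n ^+ total_size C)); last first.
  by move=> b /andP[_ /eqP ->].
rewrite sumr_const mulr_natl; congr (_ *+ _); apply: eq_card => b.
rewrite unfold_in /= [b \in placements _ _ _]inE [b \in placements_of _ _ _]inE.
have [->|_] := eqVneq (supp b.2) C; last by rewrite !andbF.
by rewrite CiCC !andbT.
Qed.

Let excess_optimal_zero C : C \in CC ->
  #|T|%:R + alpha * #|C|%:R - eta * (total_size C)%:R = 0.
Proof.
move=> /(excess_optimal e_irr hedge hbal); rewrite /excess sum_setT cardsT; exact.
Qed.

Lemma weight_sum_cvg : ws @ \oo --> \sum_(C in CC) c ^+ total_size C.
Proof.
rewrite (funext weight_sumE : ws = _); apply: cvg_sum_seq => C CiCC.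
apply: (placements_count_cvg alpha_gt0 c_gt0 hm hp (excess_optimal_zero CiCC)) => n.
  by have := card_placements_of_ge 'I_n 'I_(m n) C; rewrite !card_ord.
by have := card_placements_of_le 'I_n 'I_(m n) C; rewrite !card_ord.
Qed.

(** The exponent left for the unshared part is that of the whole pattern, which is 0, minus the
    excess of the shared part, which is positive. *)
Lemma overlap_bound_cvg0 C S D : C \in CC ->
  (fun n => overlap_bound 'I_n 'I_(m n) (p n) C S D) @ \oo --> (0 : R).
Proof.
move=> CiCC; rewrite /overlap_bound.
have [sub|_] := boolP ((D \subset C) && (S != finset.set0)); last exact: cvg_cst.
rewrite [X in _ --> X](_ : (0 : R) = overlap_const R T * 0); last by rewrite mulr0.
apply: cvgM; first exact: cvg_cst.
have [_|ne] := boolP ((S == [set: T]%SET) && (D == C)); first exact: p_cvg0.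
under eq_fun do rewrite !card_ord; apply: (count_cvg0 c_gt0 hm hp).
case/andP: sub => DC S0.
have ex : 0 < excess alpha eta S D.
  apply: (excess_gt0 e_irr hedge hbal alpha_gt0 alpha_lt CiCC DC); first by rewrite S0.
  by rewrite -negb_and.
have zero := excess_optimal_zero CiCC.
have le : (\sum_(A in D) #|A :&: S| <= total_size C)%N.
  rewrite /total_size [leqRHS](big_setID D) /= (finset.setIidPr DC).
  apply: leq_trans (leq_addr _ _); apply: leq_sum => A _.
  exact: subset_leq_card (finset.subsetIl _ _).
rewrite !natrB ?max_card ?(subset_leq_card DC) //.
by move: ex zero; rewrite /excess => ex zero; lra.
Qed.

Lemma overlap_total_cvg0 :
  (fun n => overlap_total 'I_n 'I_(m n) (p n) CC) @ \oo --> (0 : R).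
Proof.
rewrite [X in _ --> X](_ : (0 : R) =
  \sum_(C in CC) \sum_(S : {set T}) \sum_(D : {set {set T}}) 0); last first.
  by rewrite big1 // => C _; rewrite big1 // => S _; rewrite big1.
apply: cvg_sum_seq => C CiCC; apply: cvg_sum_seq => S _; apply: cvg_sum_seq => D _.
exact: overlap_bound_cvg0.
Qed.

Lemma non_optimal_prob_cvg0 C : C \in proper_covers e -> C \notin CC ->
  (fun n => subset_prob (p n) (fun G : {set 'I_n * 'I_(m n)} =>
     [exists a in placements_of 'I_n 'I_(m n) C, edges a.1 a.2 \subset G]))
  @ \oo --> (0 : R).
Proof.
move=> Cp CnCC; have [S [D DC neg]] := non_optimal_excess e_irr e_sym hedge hbal Cp CnCC.
apply: (@squeeze_norm0 _ _ (fun n => n%:R ^+ #|S| * (m n)%:R ^+ #|D| *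
    p n ^+ (\sum_(A in D) #|A :&: S|))); last first.
  by apply: (count_cvg0 c_gt0 hm hp); exact: neg.
near=> n; have p01 : 0 <= p n <= 1 by near: n.
rewrite ger0_norm ?subset_prob_ge0 //.
by have := @prob_present_le R T 'I_n 'I_(m n) (p n) p01 C D S DC; rewrite !card_ord.
Unshelve. all: end_near. Qed.

Let F n : {set {set 'I_n * 'I_(m n)}} :=
  [set edges a.1 a.2 | a in placements 'I_n 'I_(m n) CC]%SET.

Let mismatch n : R :=
  \sum_(C in proper_covers e | C \notin CC)
    subset_prob (p n) (fun G : {set 'I_n * 'I_(m n)} =>
      [exists a in placements_of 'I_n 'I_(m n) C, edges a.1 a.2 \subset G]) +
  (ws n * ((#|T| * #|{set T}|)%:R * p n) +
   ws n * ((#|T| * #|T|)%:R * ((m n)%:R * p n ^+ 2))).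

Lemma mismatch_cvg0 : mismatch @ \oo --> (0 : R).
Proof.
rewrite [X in _ --> X](_ : (0 : R) = \sum_(C in proper_covers e | C \notin CC) 0 +
  ((\sum_(C in CC) c ^+ total_size C) * ((#|T| * #|{set T}|)%:R * 0) +
   (\sum_(C in CC) c ^+ total_size C) * ((#|T| * #|T|)%:R * 0))); last first.
  by rewrite big1 // !mulr0 !addr0.
apply: cvgD.
  by apply: cvg_sum_seq => C /andP[Cp CnCC]; exact: non_optimal_prob_cvg0.
apply: cvgD; (apply: cvgM; first exact: weight_sum_cvg).
  by apply: cvgM; first exact: cvg_cst.
by apply: cvgM; first exact: cvg_cst.
Qed.

Let g n k := subset_prob (p n) (fun G : {set 'I_n * 'I_(m n)} => count_subsets (F n) G == k).

(** Copies and patterns are counted on the same [G] and agree on the good event, so the bound is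
    uniform in [k]. *)
Lemma copies_pmf_approx n k : 0 <= p n <= 1 ->
  `|copies_pmf e n (m n) (p n) k - g n k| <= mismatch n.
Proof.
move=> p01; rewrite /copies_pmf rig_probE.
apply: le_trans (subset_prob_dist p01 _ _) _.
apply: (@le_trans _ _ (subset_prob (p n) (fun G : {set 'I_n * 'I_(m n)} =>
   [exists C in [pred C | (C \in proper_covers e) && (C \notin CC)],
     [exists a in placements_of 'I_n 'I_(m n) C, edges a.1 a.2 \subset G]] ||
   (~~ no_extra_edge CC G || ~~ no_extra_object CC G)))).
  apply: subset_prob_le => // G; apply: contraNT; rewrite !negb_or.
  move=> /and3P[/fintype.existsPn hC /negPn hE /negPn hO]; rewrite (@induced_copies_count _ _ _ e CC) //.
  - by move=> C x CiCC; apply: (optimal_spanning e_irr hedge hbal alpha_gt0 alpha_lt).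
  - by move=> C s CiCC saut; exact: optimal_image.
  - apply/forallP => f; apply/forallP => q; apply/implyP => /and3P[pl qp qG].
    apply: contraT => qn; have := hC (supp q); rewrite [_ \in _]inE /= qp qn /=.
    by move=> /fintype.existsPn/(_ (f, q)); rewrite inE /= pl eqxx qG.
apply: le_trans (subset_prob_or p01 _ _) _; apply: lerD.
  exact: subset_prob_exists.
apply: le_trans (subset_prob_or p01 _ _) _; apply: lerD.
  exact: extra_edge_prob.
by have := @extra_object_prob R T 'I_n 'I_(m n) (p n) p01 CC; rewrite !card_ord.
Qed.

Let lam n := mean_subsets (p n) (F n).

(** The mean runs over edge sets and [ws] over placements; by the fibre count they differ exactly by
    the factor [#|graph_aut e|]. *)
Lemma mean_cvg : lam @ \oo --> lambda0 e alpha c.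
Proof.
have aut0 : (#|graph_aut e|%:R : R) != 0.
  rewrite pnatr_eq0 -lt0n; apply/card_gt0P; exists 1%g.
  by apply/graph_autP => x y; rewrite !perm1.
have lamE n : lam n = (#|graph_aut e|%:R)^-1 * ws n.
  rewrite /ws /weight_sum.
  have edge C x y : C \in CC ->
      e x y = (x != y) && [exists A in C, (x \in A) && (y \in A)].
    by move=> /CC_proper; exact: proper_cover_edge.
  have neq0 C A : C \in CC -> A \in C -> A != finset.set0.
    move=> /CC_proper Cp AiC; rewrite -card_gt0.
    exact: leq_trans (proper_cover_size Cp AiC).
  have span C x : C \in CC -> exists2 A, A \in C & x \in A.
    exact: (optimal_spanning e_irr hedge hbal alpha_gt0 alpha_lt).
  have aut C s : C \in CC -> s \in graph_aut e -> cover_image s C \in CC.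
    by move=> CiCC saut; exact: optimal_image.
  have := @sum_edges_fibre T 'I_n 'I_(m n) e CC edge neq0 span aut R (fun E => p n ^+ #|E|).
  rewrite (eq_bigr (fun a => p n ^+ total_size (supp a.2))); last first.
    by move=> a; rewrite inE => /andP[pl _]; rewrite card_edges.
  by move=> ->; rewrite mulKf.
rewrite /lambda0 (funext lamE : lam = _).
by apply: cvgM; [exact: cvg_cst | exact: weight_sum_cvg].
Qed.

Lemma dTV_copies_cvg0 :
  (fun n => dTV_poisson (copies_pmf e n (m n) (p n)) (lambda0 e alpha c))
    @ \oo --> (0%E : \bar R).
Proof.
have l0 : 0 <= lambda0 e alpha c.
  by rewrite /lambda0 mulr_ge0 ?invr_ge0 // sumr_ge0 // => C _; rewrite exprn_ge0 // ltW.
apply: dTV_poisson_cvg0 => //.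
- by near=> n => k; rewrite /copies_pmf rig_probE subset_prob_ge0 //; near: n.
- near=> n => K; have p01 : 0 <= p n <= 1 by near: n.
  under eq_bigr do rewrite /copies_pmf rig_probE.
  rewrite (subset_prob_sum _ (fun G : {set 'I_n * 'I_(m n)} =>
    induced_copies e (intersection_graph (assignment G)))).
  exact: subset_prob_le1.
move=> k.
(* The recursion is applied to the number of patterns contained in [G], which is a count of subsets;
   the law of the number of copies is then reached through [mismatch]. *)
have g_cvg : (fun n => g n k) @ \oo --> poisson_weight (lambda0 e alpha c) k.
  apply: (@recursion_cvg _ g (fun n => ws n * (p n + 2 * overlap_total 'I_n 'I_(m n) (p n) CC)) lam) => //.
  - by near=> n => j; rewrite subset_prob_ge0 //; near: n.
  - near=> n => K; have p01 : 0 <= p n <= 1 by near: n.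
    by rewrite subset_prob_sum; exact: subset_prob_le1.
  - near=> n => K; have p01 : 0 <= p n <= 1 by near: n.
    exact: count_subsets_tail.
  - near=> n => j; have p01 : 0 <= p n <= 1 by near: n.
    apply: le_trans (count_subsets_recursion p01 _ _) _.
    by apply: overlap_error_le.
  - exact: mean_cvg.
  rewrite [X in _ --> X](_ : (0 : R) =
    (\sum_(C in CC) c ^+ total_size C) * (0 + 2 * 0)); last by rewrite mulr0 addr0 mulr0.
  apply: cvgM; first exact: weight_sum_cvg.
  apply: cvgD; first exact: p_cvg0.
  by apply: cvgM; [exact: cvg_cst | exact: overlap_total_cvg0].
have d_cvg : (fun n => copies_pmf e n (m n) (p n) k - g n k) @ \oo --> (0 : R).
  apply: (@squeeze_norm0 _ _ mismatch); last exact: mismatch_cvg0.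
  by near=> n; apply: copies_pmf_approx; near: n.
rewrite (_ : (fun n => _) = (fun n => (copies_pmf e n (m n) (p n) k - g n k) + g n k)); last first.
  by apply/funext => n; rewrite subrK.
by rewrite -[X in _ --> X]add0r; exact: cvgD.
Unshelve. all: end_near. Qed.

End Assembly.

Theorem theorem2 (R : realType) (T : finType) (e : rel T)
  (esym : symmetric e) (eirr : irreflexive e)
  (hT : (2 <= #|T|)%N) (hedge : exists x y, e x y)
  (alpha : R) (halpha : 0 < alpha) (c : R) (hc : 0 < c)
  (m : nat -> nat) (hm : forall n, m n = Num.truncn (n%:R `^ alpha))
  (p : nat -> R)
  (hp : forall n, (0 < n)%N -> p n = c * n%:R `^ (- fine (eta0 e alpha)))
  (hmp : (fun n => (m n)%:R * p n ^+ 2) @ \oo --> (0 : R))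
  (hbal : strictly_balanced e alpha) :
  (fun n => dTV_poisson (copies_pmf e n (m n) (p n)) (lambda0 e alpha c))
    @ \oo --> (0%E : \bar R).
Proof.
exact: (dTV_copies_cvg0 esym eirr hedge halpha hc hm hp hmp hbal).
Qed.
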